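(* Let $m,p,n\geq 1$ be integers, let $\mathcal{A}_1,\dots,\mathcal{A}_n\in\mathbb{C}^{m\times m\times p}$ be fixed (deterministic) Hermitian T-product tensors, and let $\alpha_1,\dots,\alpha_n$ be independent standard normal random variables. Define $\sigma^2=\left\Vert \sum_{i=1}^n \mathcal{A}_i^2\right\Vert$. Then for all $\theta\geq 0$, $$\Pr\left(\lambda_{\max}\left(\sum_{i=1}^n \alpha_i\mathcal{A}_i\right)\geq\theta\right)\leq mp\, e^{-\theta^2/(2\sigma^2)}$$ and $$\Pr\left(\left\Vert\sum_{i=1}^n \alpha_i\mathcal{A}_i\right\Vert\geq\theta\right)\leq 2mp\, e^{-\theta^2/(2\sigma^2)}.$$ Both inequalities also hold when $\alpha_1,\dots,\alpha_n$ are instead independent Rademacher random variables.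
   Context: For $\mathcal{A}\in\mathbb{C}^{m\times n\times p}$ with frontal slices $A^{(1)},\dots,A^{(p)}\in\mathbb{C}^{m\times n}$, $\mathrm{bcirc}(\mathcal{A})\in\mathbb{C}^{mp\times np}$ is the block circulant matrix whose $(r,s)$ block ($1\le r,s\le p$) is $A^{(((r-s)\bmod p)+1)}$. The T-product of $\mathcal{A}\in\mathbb{C}^{m\times n\times p}$ and $\mathcal{B}\in\mathbb{C}^{n\times q\times p}$ is the unique $\mathcal{A}\star\mathcal{B}\in\mathbb{C}^{m\times q\times p}$ with $\mathrm{bcirc}(\mathcal{A}\star\mathcal{B})=\mathrm{bcirc}(\mathcal{A})\,\mathrm{bcirc}(\mathcal{B})$. The conjugate transpose $\mathcal{A}^{\mathrm H}\in\mathbb{C}^{n\times m\times p}$ is obtained by conjugate-transposing every frontal slice and reversing the order of slices $2,\dots,p$, so $\mathrm{bcirc}(\mathcal{A}^{\mathrm H})=\mathrm{bcirc}(\mathcal{A})^{\mathrm H}$. A tensor $\mathcal{A}\in\mathbb{C}^{m\times m\times p}$ is a Hermitian T-product tensor if $\mathcal{A}^{\mathrm H}=\mathcal{A}$; its eigenvalues are the $mp$ real eigenvalues of the Hermitian matrix $\mathrm{bcirc}(\mathcal{A})$, and $\lambda_{\max}$, $\lambda_{\min}$ denote the largest and smallest of them. Powers are T-product powers ($\mathcal{A}^2=\mathcal{A}\star\mathcal{A}$). $\Vert\mathcal{A}\Vert$ is the spectral norm, i.e. the largest singular value of $\mathrm{bcirc}(\mathcal{A})$. *)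

(* Defs.v *)
From HB Require Import structures.
From mathcomp Require Import all_boot all_order all_algebra.
From mathcomp Require Import all_classical all_reals all_analysis.
From mathcomp Require Import complex.

Set Implicit Arguments.
Unset Strict Implicit.
Unset Printing Implicit Defensive.

Import Order.TTheory GRing.Theory Num.Theory.
Local Open Scope classical_set_scope.
Local Open Scope ring_scope.

(* A third-order tensor in C^{m x n x p}, given by its p frontal slices.
   Slice index k : 'I_p (0-based) stands for A^{(k+1)}. *)
Definition tensor (R : realType) (m n p : nat) := {ffun 'I_p -> 'M[R[i]]_(m, n)}.

(* ((r - s) mod p), computed in nat; valid since s < p. *)
Definition circ_idx (p : nat) (r s : 'I_p) : 'I_p :=
  Ordinal (ltn_pmod (r + p - s) (leq_ltn_trans (leq0n r) (ltn_ord r))).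

Definition rev_idx (p : nat) (k : 'I_p) : 'I_p :=
  Ordinal (ltn_pmod (p - k) (leq_ltn_trans (leq0n k) (ltn_ord k))).

Definition bcirc (R : realType) m n p (A : tensor R m n p) :
  'M[R[i]]_(\sum_(r < p) m, \sum_(s < p) n) :=
  \mxblock_(r < p, s < p) A (circ_idx r s).

(* T-product: the tensor whose bcirc is bcirc A *m bcirc B
   (its k-th slice is the k-th block of the first block column of that product). *)
Definition tprod (R : realType) m n q p (A : tensor R m n p) (B : tensor R n q p) :
  tensor R m q p :=
  [ffun k => \sum_(s < p) A (circ_idx k s) *m B s].

(* Conjugate transpose: conjugate-transpose every slice, reverse slices 2..p. *)
Definition tconjT (R : realType) m n p (A : tensor R m n p) : tensor R n m p :=
  [ffun k => map_mx Num.conj (A (rev_idx k))^T].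

Definition tHermitian (R : realType) m p (A : tensor R m m p) : Prop :=
  tconjT A = A.

(* Largest eigenvalue of a square complex matrix, taken over its real eigenvalues
   (all eigenvalues are real for a Hermitian matrix). *)
Definition lambda_max_mx (R : realType) (N : nat) (M : 'M[R[i]]_N) : R :=
  sup [set x : R | eigenvalue M x%:C%C].

Definition spec_norm_mx (R : realType) (a b : nat) (M : 'M[R[i]]_(a, b)) : R :=
  Num.sqrt (lambda_max_mx (map_mx Num.conj M^T *m M)).

Definition tlambda_max (R : realType) m p (A : tensor R m m p) : R :=
  lambda_max_mx (bcirc A).

Definition tnorm (R : realType) m n p (A : tensor R m n p) : R :=
  spec_norm_mx (bcirc A).

Definition mutually_independent d (T : measurableType d) (R : realType)
  (P : probability T R) (n : nat) (X : 'I_n -> {RV P >-> R}) : Prop :=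
  forall B : 'I_n -> set R, (forall i, measurable (B i)) ->
    P (\bigcap_i (X i @^-1` B i)) = (\prod_(i < n) P (X i @^-1` B i))%E.

Definition standard_normal_rv d (T : measurableType d) (R : realType)
  (P : probability T R) (X : {RV P >-> R}) : Prop :=
  forall B : set R, measurable B -> distribution P X B = normal_prob 0 1 B.

Definition rademacher_rv d (T : measurableType d) (R : realType)
  (P : probability T R) (X : {RV P >-> R}) : Prop :=
  P (X @^-1` [set 1]) = (2^-1)%:E /\ P (X @^-1` [set -1]) = (2^-1)%:E.

Definition tcomb (R : realType) m p n (alpha : 'I_n -> R) (A : 'I_n -> tensor R m m p) :
  tensor R m m p := \sum_(i < n) (alpha i)%:C%C *: A i.

(* Main.v *)
(* The proof is a moment method; no matrix exponential is needed. Write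
   X = sum_i alpha_i A_i for the Hermitian matrices A_i = bcirc of the given
   tensors. Integration by parts (Gaussian case) or flipping the sign of one
   coordinate (Rademacher case) turns E tr X^(2t+2) into a sum of terms
   E tr (A_i X^q A_i X'^(2t-q)). In eigenbases these have nonnegative
   coefficients, so averaging q with 2t-q bounds them by E tr (A_i^2 X^(2t)),
   and hence E tr X^(2t+2) <= (2t+1) sigma^2 E tr X^(2t), while odd moments
   vanish. Markov's inequality applied to tr (1 + s X / m)^m for even m, followed
   by m -> oo and s = theta / sigma^2, gives the first bound with the sharp
   constant. The second follows from ||X|| = max (lambda_max X, lambda_max (-X)).
   Nonmeasurable sets have no meaningful probability, so the events are also
   shown to be measurable, through countably many conditions on tr X^k. *)

Require Import Defs.
From HB Require Import structures.
From mathcomp Require Import all_boot all_order all_algebra.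
From mathcomp Require Import all_classical all_reals all_analysis.
From mathcomp Require Import complex ring lra zify measurable_realfun.

Import Order.TTheory GRing.Theory Num.Theory.
Local Open Scope classical_set_scope.
Local Open Scope ring_scope.

Set Implicit Arguments.
Unset Strict Implicit.
Unset Printing Implicit Defensive.

(** The obstacle is that the [A_i] do not commute: the exponential of the sum does not factor, so
    the scalar Laplace transform argument does not carry over. Moments avoid this, because the only
    noncommutative estimate they need compares traces that are sums over pairs of eigenvalues with
    common nonnegative weights. The factor 2t+1 in the recursion counts the positions in X^(2t+1) at
    which a factor can be replaced by A_i. Iterating gives E tr X^(2t) <= (2t-1)!! sigma^(2t) N,
    where N is the size of X: this is N times the moment of a centred normal variable of variance
    sigma^2. Hence the generating function N exp(s^2 sigma^2 / 2) and the sharp constant. A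
    polynomial in place of the exponential keeps every expectation a finite sum, and its even degree
    makes each eigenvalue contribute nonnegatively. Independence and both laws are given on sets
    only, so a good part of the development turns them into statements about expectations of
    polynomials. *)

Local Notation adj M := (map_mx Num.conj M^T).
Local Notation Retr M := (complex.Re (\tr M)).

(** * Powers and traces under a change of basis *)

Section AbstractMatrixIdentities.
Context {K : comPzRingType} {N : nat}.
Implicit Types (U V A D E : 'M[K]_N).

Lemma mx_expr0 A : A ^+ 0 = 1%:M. Proof. by []. Qed.

Lemma mx_exprS A k : A ^+ k.+1 = A *m A ^+ k.
Proof. by rewrite exprS. Qed.

Lemma diag_mxX (D : 'rV[K]_N) k : (diag_mx D) ^+ k = diag_mx (\row_j D 0 j ^+ k).
Proof.
elim: k => [|k IH].
  by rewrite mx_expr0 -diag_const_mx; congr diag_mx; apply/rowP => j; rewrite !mxE expr0.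
rewrite mx_exprS IH mulmx_diag; congr diag_mx; apply/rowP => j.
by rewrite !mxE exprS.
Qed.

Lemma conj_mxX U V D k : U *m V = 1%:M -> V *m U = 1%:M ->
  (V *m D *m U) ^+ k = V *m D ^+ k *m U.
Proof.
move=> UV VU; elim: k => [|k IH]; first by rewrite !mx_expr0 mulmx1 VU.
by rewrite !mx_exprS IH -!mulmxA !(mulmxA U) UV mul1mx !mulmxA.
Qed.

Lemma mxtrace_conj U V D : U *m V = 1%:M -> \tr (V *m D *m U) = \tr D.
Proof. by move=> UV; rewrite mxtrace_mulC mulmxA UV mul1mx. Qed.

Lemma mxtrace_sandwich A U U' D V V' E :
  \tr (A *m (U' *m D *m U) *m A *m (V' *m E *m V)) =
  \tr ((V *m A *m U') *m (D *m ((U *m A *m V') *m E))).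
Proof. by rewrite !mulmxA mxtrace_mulC !mulmxA. Qed.

End AbstractMatrixIdentities.

(** * Eigendecompositions of Hermitian matrices *)

Section HermitianSpectral.
Context {R : realType} {N : nat}.
Implicit Types (M A Y Z : 'M[R[i]]_N) (U : 'M[R[i]]_N) (y : 'I_N -> R).

Lemma ReD (x y : R[i]) : complex.Re (x + y) = complex.Re x + complex.Re y.
Proof. by case: x => ? ?; case: y => ? ?. Qed.

Lemma ReN (x : R[i]) : complex.Re (- x) = - complex.Re x.
Proof. by case: x. Qed.

Lemma Re_sum (I : Type) (r : seq I) (Q : pred I) (F : I -> R[i]) :
  complex.Re (\sum_(i <- r | Q i) F i) = \sum_(i <- r | Q i) complex.Re (F i).
Proof. by apply: (big_morph (@complex.Re R)) => // x y; rewrite ReD. Qed.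

Lemma ReM_real (a : R) (x : R[i]) : complex.Re (a%:C%C * x) = a * complex.Re x.
Proof. by case: x => ? ?; rewrite /= mul0r subr0. Qed.

Lemma RetrD (A B : 'M[R[i]]_N) : Retr (A + B) = Retr A + Retr B.
Proof. by rewrite mxtraceD ReD. Qed.

Lemma RetrN (A : 'M[R[i]]_N) : Retr (- A) = - Retr A.
Proof. by rewrite raddfN ReN. Qed.

Lemma RetrZ (x : R) (A : 'M[R[i]]_N) : Retr (x%:C%C *: A) = x * Retr A.
Proof. by rewrite mxtraceZ ReM_real. Qed.

Lemma Retr_sum (I : Type) (r : seq I) (Q : pred I) (F : I -> 'M[R[i]]_N) :
  Retr (\sum_(i <- r | Q i) F i) = \sum_(i <- r | Q i) Retr (F i).
Proof.
apply: (big_morph (fun M : 'M[R[i]]_N => Retr M) RetrD).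
by rewrite mxtrace0.
Qed.

Lemma ctmxM (a b c : nat) (A : 'M[R[i]]_(a, b)) (B : 'M[R[i]]_(b, c)) :
  adj (A *m B) = adj B *m adj A.
Proof. by rewrite trmx_mul map_mxM. Qed.

Lemma ctmxK (a b : nat) (A : 'M[R[i]]_(a, b)) : adj (adj A) = A.
Proof. by apply/matrixP => i j; rewrite !mxE conjCK. Qed.

Lemma conj_realC (x : R) : Num.conj (x%:C%C : R[i]) = x%:C%C.
Proof. by apply: CrealP; apply/complex_realP; exists x. Qed.

Lemma ctmxD (a b : nat) (A B : 'M[R[i]]_(a, b)) : adj (A + B) = adj A + adj B.
Proof. by apply/matrixP => i j; rewrite !mxE rmorphD. Qed.

Lemma ctmxZ (a b : nat) (x : R) (A : 'M[R[i]]_(a, b)) :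
  adj (x%:C%C *: A) = x%:C%C *: adj A.
Proof. by apply/matrixP => i j; rewrite !mxE rmorphM /= conj_realC. Qed.

(** The eigenvalues are kept as real numbers, so that all later comparisons take place in the
    ordered field [R]. *)
Definition eigdec M U y :=
  [/\ U *m adj U = 1%:M, adj U *m U = 1%:M
    & M = adj U *m diag_mx (\row_j (y j)%:C%C) *m U].

Lemma herm_eigdec M : adj M = M -> exists U y, eigdec M U y.
Proof.
move=> hM.
have hM' : M \is hermsymmx.
  by apply/is_hermitianmxP; rewrite expr0 scale1r -{1}hM.
have uS := spectral_unitarymx M.
have e1 : spectralmx M *m adj (spectralmx M) = 1%:M by apply/unitarymxP.
exists (spectralmx M), (fun j => complex.Re (spectral_diag M 0 j)); split => //.
- exact: mulmx1C.
- have spE : spectral_diag M = \row_j (complex.Re (spectral_diag M 0 j))%:C%C.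
    apply/rowP => j; rewrite mxE.
    by have /mxOverP/(_ 0 j)/RRe_real := hermitian_spectral_diag_real hM'.
  have /hermitian_normalmx/orthomx_spectralP := hM'.
  by rewrite (invmx_unitary uS) {1}spE.
Qed.

Lemma eigdecX {M U y} k : eigdec M U y -> eigdec (M ^+ k) U (fun j => y j ^+ k).
Proof.
move=> [e1 e2 eM]; split; [exact: e1 | exact: e2 |].
have -> : \row_j (y j ^+ k)%:C%C = \row_j (\row_j (y j)%:C%C : 'rV[R[i]]_N) 0 j ^+ k.
  by apply/rowP => j; rewrite !mxE rmorphXn.
by rewrite -diag_mxX -conj_mxX // -eM.
Qed.

Lemma eigdec_herm {M U y} : eigdec M U y -> adj M = M.
Proof.
move=> [_ _ ->]; rewrite !ctmxM ctmxK mulmxA; congr (_ *m _ *m _).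
rewrite tr_diag_mx map_diag_mx; congr diag_mx; apply/rowP => j; rewrite !mxE; exact: conj_realC.
Qed.

Lemma eigdec_trX {M U y} k : eigdec M U y -> Retr (M ^+ k) = \sum_j y j ^+ k.
Proof.
move=> /(eigdecX k) [e1 e2 ->]; rewrite mxtrace_conj // mxtrace_diag.
by rewrite Re_sum; apply: eq_bigr => j _; rewrite mxE.
Qed.

(** With [W = U *m A *m adj V] the weight [c a b] is the squared modulus of [W a b]; hermiticity of
    [A] makes the other transition matrix the adjoint of [W]. The weights do not depend on the
    exponents, so trace inequalities reduce to scalar ones for each pair of eigenvalues. *)
Lemma eigdec_tr_sandwich A Y Z U V y z :
  adj A = A -> eigdec Y U y -> eigdec Z V z ->
  exists2 c : 'I_N -> 'I_N -> R, (forall a b, 0 <= c a b) &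
  forall q r, Retr (A *m Y ^+ q *m A *m Z ^+ r) =
    \sum_a \sum_b c a b * (y a ^+ q * z b ^+ r).
Proof.
move=> hA dY dZ; pose W := U *m A *m adj V.
exists (fun a b => complex.Re (W a b * Num.conj (W a b))) => [a b|q r].
  have : 0 <= W a b * Num.conj (W a b) by rewrite -normCK exprn_ge0.
  by rewrite lecE => /andP[].
have [_ _ ->] := eigdecX q dY; have [_ _ ->] := eigdecX r dZ.
set D := diag_mx _; set E := diag_mx _; rewrite mxtrace_sandwich.
have -> : V *m A *m adj U = adj W by rewrite /W !ctmxM ctmxK hA mulmxA.
rewrite -/W.
rewrite /mxtrace Re_sum exchange_big /=; apply: eq_bigr => b _.
rewrite mxE Re_sum; apply: eq_bigr => a _.
rewrite mul_diag_mx mul_mx_diag !mxE.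
rewrite -[RHS]mulrC -ReM_real; congr complex.Re.
by rewrite rmorphM /=; ring.
Qed.

End HermitianSpectral.

(** * Trace inequalities and extreme eigenvalues *)

Section HermitianInequalities.
Context {R : realType} {N : nat}.
Implicit Types (M A Y Z : 'M[R[i]]_N) (U : 'M[R[i]]_N) (y : 'I_N -> R).

(* Since |x|^q and |x|^r are increasing in |x|, (|x|^q - |y|^q)(|x|^r - |y|^r) >= 0. *)
Lemma cross_pow_le (x y : R) (q r : nat) : ~~ odd (q + r) ->
  x ^+ q * y ^+ r + x ^+ r * y ^+ q <= x ^+ (q + r) + y ^+ (q + r).
Proof.
move=> ev.
have nE (u : R) : u ^+ (q + r) = `|u| ^+ (q + r).
  by rewrite -normrX ger0_norm // exprn_even_ge0.
have le1 : x ^+ q * y ^+ r + x ^+ r * y ^+ q <=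
    `|x| ^+ q * `|y| ^+ r + `|x| ^+ r * `|y| ^+ q.
  by apply: lerD; rewrite -!normrX -normrM ler_norm.
apply: (le_trans le1); rewrite (nE x) (nE y) !exprD -subr_ge0.
set a := `|x|; set b := `|y|.
have -> : a ^+ q * a ^+ r + b ^+ q * b ^+ r - (a ^+ q * b ^+ r + a ^+ r * b ^+ q) =
   (a ^+ q - b ^+ q) * (a ^+ r - b ^+ r) by ring.
case: (leP a b) => [ab|/ltW ab].
  by rewrite -mulrNN; apply: mulr_ge0; rewrite opprB subr_ge0 lerXn2r ?nnegrE ?normr_ge0.
by apply: mulr_ge0; rewrite subr_ge0 lerXn2r ?nnegrE ?normr_ge0.
Qed.

(** The right-hand traces are the same sandwich with exponents (q + r, 0) and (0, q + r), so all
    four traces share their weights and [cross_pow_le] applies termwise. Two matrices are needed for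
    the Rademacher case, where [Z] is [Y] after a sign flip. *)
Lemma Retr_sandwich_le A Y Z (q r : nat) : adj A = A -> adj Y = Y -> adj Z = Z ->
  ~~ odd (q + r) ->
  Retr (A *m Y ^+ q *m A *m Z ^+ r) + Retr (A *m Y ^+ r *m A *m Z ^+ q) <=
  Retr (A *m A *m Y ^+ (q + r)) + Retr (A *m A *m Z ^+ (q + r)).
Proof.
move=> hA /herm_eigdec[U [y dY]] /herm_eigdec[V [z dZ]] ev.
have [c c0 cE] := eigdec_tr_sandwich hA dY dZ.
have eY : Retr (A *m A *m Y ^+ (q + r)) = \sum_a \sum_b c a b * (y a ^+ (q + r) * z b ^+ 0).
  by rewrite -cE mx_expr0 mulmx1 -mulmxA mxtrace_mulC.
have eZ : Retr (A *m A *m Z ^+ (q + r)) = \sum_a \sum_b c a b * (y a ^+ 0 * z b ^+ (q + r)).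
  by rewrite -cE mx_expr0 mulmx1.
rewrite (cE q r) (cE r q) eY eZ -!big_split; apply: ler_sum => a _; rewrite -!big_split.
apply: ler_sum => b _; rewrite /= -!mulrDr ler_wpM2l //.
by rewrite !expr0 mul1r mulr1 cross_pow_le.
Qed.

(** Both sides are sandwiches around the identity, with [B ^+ 1] and [B ^+ 0] as last factor. Since
    [t] is even, the powers of the eigenvalues of [Y] are nonnegative and each [b j] may be replaced
    by [s]. *)
Lemma Retr_mul_le (B Y : 'M[R[i]]_N) V (b : 'I_N -> R) (s : R) (t : nat) :
  adj Y = Y -> eigdec B V b -> (forall j, b j <= s) -> ~~ odd t ->
  Retr (B *m Y ^+ t) <= s * Retr (Y ^+ t).
Proof.
move=> /herm_eigdec[U [y dY]] dB bs ev.
have [|c c0 cE] := @eigdec_tr_sandwich R N 1%:M Y B U V y b _ dY dB.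
  by rewrite trmx1 map_mx1.
have -> : \tr (B *m Y ^+ t) = \tr (1%:M *m Y ^+ t *m 1%:M *m B ^+ 1).
  by rewrite mul1mx mulmx1 expr1 mxtrace_mulC.
have -> : Y ^+ t = 1%:M *m Y ^+ t *m 1%:M *m B ^+ 0.
  by rewrite mx_expr0 mul1mx !mulmx1.
rewrite mul1mx mulmx1 mx_expr0 !mulmx1.
have := cE t 1%N; rewrite mul1mx mulmx1 => ->.
have := cE t 0%N; rewrite mul1mx mx_expr0 !mulmx1 => ->.
rewrite mulr_sumr; apply: ler_sum => i _; rewrite mulr_sumr; apply: ler_sum => j _.
rewrite expr1 expr0 mulr1 [leRHS]mulrCA ler_wpM2l // mulrC ler_wpM2r //.
exact: exprn_even_ge0.
Qed.

(** Eigenvectors are row vectors here: [v *m adj U] is an eigenvector of the diagonal matrix, and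
    conversely row [j] of [U] belongs to [y j]. *)
Lemma eigdec_eigenvalue M U y (x : R) : eigdec M U y ->
  eigenvalue M x%:C%C <-> exists j, y j = x.
Proof.
move=> [e1 e2 eM]; split.
  move/eigenvalueP => [v vM v0].
  have w0 : v *m adj U != 0.
    by apply: contraNneq v0 => w0; rewrite -[v]mulmx1 -e2 mulmxA w0 mul0mx.
  have [j wj] : exists j, (v *m adj U) 0 j != 0.
    apply/existsP; rewrite -negb_forall; apply: contra w0 => /forallP w0.
    by apply/eqP/rowP => j; rewrite [RHS]mxE; apply/eqP.
  exists j; have : v *m adj U *m diag_mx (\row_j (y j)%:C%C) = x%:C%C *: (v *m adj U).
    by rewrite scalemxAl -vM eM !mulmxA -(mulmxA _ U) e1 mulmx1.
  move/rowP => /(_ j); rewrite mul_mx_diag !mxE mulrC => /mulIf.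
  rewrite mxE in wj => /(_ wj); exact: complexI.
move=> [j <-]; apply/eigenvalueP; exists (row j U); last first.
  apply/eqP => r0; have := congr1 (fun v => v *m adj U) r0.
  rewrite mul0mx -row_mul e1 => /rowP/(_ j); rewrite !mxE eqxx => /eqP.
  by rewrite oner_eq0.
rewrite {1}eM !mulmxA -row_mul e1 row1 -rowE row_diag_mx mxE.
by rewrite -scalemxAl -rowE.
Qed.

Lemma sup_range_fin (I : finType) (j0 : I) (y : I -> R) :
  exists j, sup (range y) = y j /\ forall i, y i <= y j.
Proof.
pose j := [arg max_(i > j0) y i]%O; exists j.
have mx : forall i, y i <= y j.
  by rewrite /j; case: arg_maxP => // i _ h k; apply: h.
split=> //; apply/eqP; rewrite eq_le; apply/andP; split.
  by apply: ge_sup => [|_ [i _ <-]]; [exists (y j0), j0 | exact: mx].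
by apply: ub_le_sup; [exists (y j) => _ [i _ <-]; exact: mx | exists j].
Qed.

Lemma lambda_max_eigdec M U y : (0 < N)%N -> eigdec M U y ->
  exists j, lambda_max_mx M = y j /\ forall i, y i <= y j.
Proof.
move=> N0 dM; have [j hj] := sup_range_fin (Ordinal N0) y; exists j.
rewrite /lambda_max_mx (_ : [set x | _] = range y) //.
apply/seteqP; split => x /=.
  by move=> /(eigdec_eigenvalue _ dM)[i <-]; exists i.
by move=> [i _ <-]; apply/(eigdec_eigenvalue _ dM); exists i.
Qed.

(** For Hermitian [M] the Gram matrix is [M ^+ 2], whose eigenvalues are the squares of those of
    [M]. *)
Lemma spec_norm_eigdec M U y : (0 < N)%N -> eigdec M U y ->
  exists j, spec_norm_mx M = `|y j| /\ forall i, `|y i| <= `|y j|.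
Proof.
move=> N0 dM; rewrite /spec_norm_mx (eigdec_herm dM).
have -> : M *m M = M ^+ 2 by [].
have [j [-> mx]] := lambda_max_eigdec N0 (eigdecX 2 dM).
exists j; rewrite sqrtr_sqr; split => // i.
by rewrite -ler_sqr ?nnegrE // !real_normK ?num_real.
Qed.

End HermitianInequalities.

(** * Block circulant matrices and the T-product *)

Section BlockCirculant.
Context {R : realType}.

Lemma circ_idxE (p : nat) (r s : 'I_p) :
  circ_idx r s = (if s <= r then r - s else r + p - s)%N :> nat.
Proof.
have rp := ltn_ord r; have sp := ltn_ord s; rewrite /=; case: leqP => rs.
  by rewrite addnC -addnBA // modnDl modn_small //; lia.
by rewrite modn_small //; lia.
Qed.

(** This is (r - t) - (s - t) = r - s modulo p, the index identity that makes [bcirc]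
    multiplicative. *)
Lemma circ_idx_comp (p : nat) (r s t : 'I_p) :
  circ_idx (circ_idx r t) (circ_idx s t) = circ_idx r s.
Proof.
apply: ord_inj; rewrite !circ_idxE.
have := ltn_ord r; have := ltn_ord s; have := ltn_ord t.
by do !case: ifP; lia.
Qed.

Lemma circ_idx_inj (p : nat) (s : 'I_p) : injective (@circ_idx p ^~ s).
Proof.
move=> r t /(congr1 (@nat_of_ord p)); rewrite !circ_idxE => e; apply: ord_inj; move: e.
have := ltn_ord r; have := ltn_ord s; have := ltn_ord t.
by do !case: ifP; lia.
Qed.

Lemma rev_circ_idx (p : nat) (r s : 'I_p) : rev_idx (circ_idx r s) = circ_idx s r.
Proof.
apply: ord_inj; rewrite circ_idxE.
have -> : rev_idx (circ_idx r s) = ((p - circ_idx r s) %% p)%N :> nat by [].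
rewrite circ_idxE.
have := ltn_ord r; have := ltn_ord s.
case: (ltngtP r s) => [rs|rs|->] sp rp.
- by rewrite modn_small; lia.
- by rewrite modn_small; lia.
- by rewrite subnn subn0 modnn.
Qed.

Lemma bcirc_tprod m n q p (A : tensor R m n p) (B : tensor R n q p) :
  bcirc (tprod A B) = bcirc A *m bcirc B.
Proof.
rewrite /bcirc mul_mxblock; apply/eq_mxblock => r s.
rewrite ffunE (reindex_inj (@circ_idx_inj p s)).
by apply: eq_bigr => t _; rewrite circ_idx_comp.
Qed.

Lemma bcirc_tconjT m n p (A : tensor R m n p) : bcirc (tconjT A) = adj (bcirc A).
Proof.
rewrite /bcirc tr_mxblock; apply/matrixP => i j; rewrite !mxE /= ffunE.
by rewrite rev_circ_idx !mxE.
Qed.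

Lemma bcirc_sum m n p (I : finType) (F : I -> tensor R m n p) :
  bcirc (\sum_i F i) = \sum_i bcirc (F i).
Proof. by rewrite /bcirc -mxblock_sum; apply/eq_mxblock => a b; rewrite sum_ffunE. Qed.

Lemma bcirc_scale m n p (c : R[i]) (F : tensor R m n p) :
  bcirc (c *: F) = c *: bcirc F.
Proof. by apply/matrixP => i j; rewrite !mxE /= ffunE !mxE. Qed.

End BlockCirculant.

(** * Double factorials and exponential estimates *)

Section ExponentialEstimates.
Context {R : realType}.
Implicit Types x y : R.

(** The double factorial (2t-1)!!, which is the moment of order 2t of a standard normal variable. *)
Definition odd_fact (t : nat) : nat := (\prod_(j < t) (2 * j + 1))%N.

Lemma odd_factS t : odd_fact t.+1 = (odd_fact t * (2 * t + 1))%N.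
Proof. by rewrite /odd_fact big_ord_recr. Qed.

Lemma fact_double t : ((2 * t)`! = 2 ^ t * t`! * odd_fact t)%N.
Proof.
elim: t => [|t IH]; first by rewrite /odd_fact big_ord0.
have -> : (2 * t.+1 = (2 * t).+2)%N by lia.
rewrite factS factS IH odd_factS [t.+1`!]factS expnS; nia.
Qed.

Lemma ffact_le_exp n k : (n ^_ k <= n ^ k)%N.
Proof.
elim: k => [|k IH]; first by rewrite ffactn0.
by rewrite ffactnSr expnSr leq_mul // leq_subr.
Qed.

(** A falling factorial m(m-1)...(m-k+1) is at most m^k. The bound is uniform in [m], so passing
    from the exponential to the polynomial costs nothing in the expectation. *)
Lemma bin_scaled_le (m k : nat) x : 0 <= x -> (0 < m)%N ->
  'C(m, k)%:R * (x / m%:R) ^+ k <= x ^+ k / k`!%:R.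
Proof.
move=> x0 m0; rewrite exprMn mulrCA ler_wpM2l ?exprn_ge0 // exprVn.
rewrite ler_pdivrMr ?exprn_gt0 ?ltr0n // mulrC ler_pdivlMr ?ltr0n ?fact_gt0 //.
by rewrite -natrM bin_ffact -natrX ler_nat ffact_le_exp.
Qed.

Lemma exp_partial_le x K : 0 <= x -> \sum_(t < K) x ^+ t / t`!%:R <= expR x.
Proof.
move=> x0; have -> : \sum_(t < K) x ^+ t / t`!%:R = series (exp_coeff x) K.
  by rewrite /series /= big_mkord.
rewrite /expR; apply: nondecreasing_cvgn_le; last exact: is_cvg_series_exp_coeff.
apply/nondecreasing_seqP => k; rewrite seriesSr lerDl.
exact: exp_coeff_ge0.
Qed.

(** With u = x / m this is the m-th power of exp(u - u^2) <= 1 + u, which follows from exp(-(u -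
    u^2)) >= 1 - u + u^2 and (1 + u)(1 - u + u^2) = 1 + u^3 >= 1. *)
Lemma expR_le_pow x (m : nat) : 0 <= x -> (0 < m)%N ->
  expR (x - x ^+ 2 / m%:R) <= (1 + x / m%:R) ^+ m.
Proof.
move=> x0 m0; have m0' : 0 < m%:R :> R by rewrite ltr0n.
set u := x / m%:R; have u0 : 0 <= u by rewrite divr_ge0 // ltW.
have -> : x - x ^+ 2 / m%:R = (u - u ^+ 2) *+ m.
  by rewrite -mulr_natr /u; field; rewrite gt_eqF.
rewrite -[(u - u ^+ 2) *+ m]mulr_natl expRM_natl lerXn2r ?nnegrE ?expR_ge0 //; first lra.
have h : 1 - (u - u ^+ 2) <= expR (- (u - u ^+ 2)) by exact: expR_ge1Dx.
move: h; rewrite expRN => h.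
have e0 := expR_gt0 (u - u ^+ 2).
have h1 : 0 < 1 - (u - u ^+ 2) by nra.
have : expR (u - u ^+ 2) <= (1 - (u - u ^+ 2))^-1.
  by rewrite -[leLHS]invrK lef_pV2 // posrE ?invr_gt0.
move/le_trans; apply; rewrite -[leRHS]invrK lef_pV2 ?posrE ?invr_gt0; try lra.
rewrite -[leLHS]mul1r ler_pdivrMr; last lra.
nra.
Qed.

(** If [p] exceeded the claimed bound by a factor exp(d) with d > 0, any m > |y| / d would
    contradict the hypothesis. *)
Lemma le_expR_limit (C p x y : R) : 0 < C ->
  (forall m : nat, (0 < m)%N -> p <= C * expR (x + y / m%:R)) -> p <= C * expR x.
Proof.
move=> C0 h; rewrite leNgt; apply/negP => lt.
have Cx : 0 < C * expR x by rewrite mulr_gt0 // expR_gt0.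
have r1 : 1 < p / (C * expR x) by rewrite ltr_pdivlMr // mul1r.
have d0 : 0 < ln (p / (C * expR x)) by rewrite ln_gt0.
set d := ln _ in d0.
have [m] : exists m : nat, `|y| / d < m%:R.
  by exists (Num.bound (`|y| / d)); rewrite archi_boundP // divr_ge0 // ltW.
case: m => [|m]; first by rewrite ltNge divr_ge0 // ltW.
move=> hm; have := h m.+1 isT; apply/negP; rewrite -ltNge.
have -> : p = C * expR (x + d).
  rewrite expRD mulrA lnK ?posrE ?(lt_trans _ r1) // mulrC divfK //.
  by rewrite gt_eqF.
rewrite ltr_pM2l // ltr_expR ltrD2l (le_lt_trans (ler_norm _)) //.
rewrite normrM normfV [`|m.+1%:R|]ger0_norm // ltr_pdivrMr ?ltr0n //.
by rewrite mulrC -ltr_pdivrMr.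
Qed.

End ExponentialEstimates.

(** * Shifted trace powers and eigenvalue thresholds *)

Section ShiftedTracePowers.
Import numFieldNormedType.Exports.
Context {R : realType} {N : nat}.
Implicit Types (M : 'M[R[i]]_N) (a b : R).

(* The trace of [(a M + b I)^m] for Hermitian [M], expanded so that measurability and
   expectations reduce to the trace powers of [M]. *)
Definition trpow (m : nat) a b M : R :=
  \sum_(k < m.+1) ('C(m, k)%:R * b ^+ (m - k) * a ^+ k) * Retr (M ^+ k).

Lemma eigdec_trpow m a b M U y : eigdec M U y ->
  trpow m a b M = \sum_j (b + a * y j) ^+ m.
Proof.
move=> dM; rewrite /trpow.
under eq_bigr do rewrite (eigdec_trX _ dM) mulr_sumr.
rewrite exchange_big; apply: eq_bigr => j _ /=.
rewrite exprDn; apply: eq_bigr => k _.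
by rewrite -[RHS]mulr_natl exprMn !mulrA.
Qed.

Lemma trpow_even_ge0 m a b M : adj M = M -> ~~ odd m -> 0 <= trpow m a b M.
Proof.
move=> /herm_eigdec[U [y dM]] em; rewrite (eigdec_trpow _ _ _ dM).
by apply: sumr_ge0 => j _; exact: exprn_even_ge0.
Qed.

(** Even [m] makes all eigenvalue terms nonnegative, so the top one alone is a lower bound; the sign
    conditions keep its base in the range where powers are monotone. *)
Lemma trpow_ge m a b M (theta : R) : (0 < N)%N -> adj M = M -> ~~ odd m ->
  0 <= a -> 0 <= b -> 0 <= theta -> theta <= lambda_max_mx M ->
  (b + a * theta) ^+ m <= trpow m a b M.
Proof.
move=> N0 /herm_eigdec[U [y dM]] em a0 b0 t0.
have [j [-> _]] := lambda_max_eigdec N0 dM => tj.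
rewrite (eigdec_trpow _ _ _ dM) (bigD1 j) //=.
have le1 : b + a * theta <= b + a * y j by rewrite lerD2l ler_wpM2l.
have ge0 : 0 <= b + a * theta by rewrite addr_ge0 // mulr_ge0.
apply: le_trans (lerXn2r m _ _ le1) _; rewrite ?nnegrE //.
  exact: le_trans le1.
by rewrite lerDl; apply: sumr_ge0 => i _; exact: exprn_even_ge0.
Qed.

Lemma exists_pow_lt (c x y : R) : 0 <= x -> x < y ->
  exists k : nat, c * x ^+ (2 * k) < y ^+ (2 * k).
Proof.
move=> x0 xy; have y0 : 0 < y by exact: le_lt_trans xy.
pose z := (x / y) ^+ 2.
have q1 : x / y < 1 by rewrite ltr_pdivrMr // mul1r.
have q0 : 0 <= x / y by rewrite divr_ge0 // ltW.
have z1 : `|z| < 1.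
  by rewrite ger0_norm ?sqr_ge0 // expr_lt1.
have : (fun k => c * z ^+ k) @ \oo --> c * 0.
  by apply: cvgMr; exact: cvg_expr.
rewrite mulr0 => /cvgr_lt /(_ 1 ltr01) [k _ /(_ k (leqnn k))] /= hk.
exists k; move: hk; rewrite /z -exprM expr_div_n mulrA ltr_pdivrMr ?exprn_gt0 //.
by rewrite mul1r.
Qed.

(** Even powers do not see signs, so without a shift a large negative eigenvalue could dominate the
    trace. Once [c] makes all shifted eigenvalues nonnegative, the trace is at most N (c +
    lambda_max)^(2k), and if lambda_max < theta this falls below (c + theta)^(2k) for some [k]. *)
Lemma le_lambda_max_trpow M (theta : R) : (0 < N)%N -> adj M = M -> 0 <= theta ->
  theta <= lambda_max_mx M <->
  forall c k : nat, (c%:R + theta) ^+ (2 * k) <= trpow (2 * k) 1 c%:R M.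
Proof.
move=> N0 hM t0; split=> [le c k|h].
  rewrite -[theta]mul1r; apply: trpow_ge => //.
  by rewrite mul2n odd_double.
rewrite leNgt; apply/negP.
have [U [y dM]] := herm_eigdec hM.
have [j [-> mx]] := lambda_max_eigdec N0 dM => lt.
pose c := Num.bound (\sum_i `|y i|).
have yc i : `|y i| <= c%:R.
  apply: (@le_trans _ _ (\sum_i `|y i|)).
    by rewrite (bigD1 i) //= lerDl sumr_ge0.
  by apply/ltW/archi_boundP; exact: sumr_ge0.
have ync i : 0 <= c%:R + y i.
  by have := yc i; rewrite ler_norml => /andP[? _]; lra.
have [|k] := @exists_pow_lt N%:R (c%:R + y j) (c%:R + theta) (ync j).
  by rewrite ltrD2l.
apply/negP; rewrite -leNgt; apply: le_trans (h c k) _.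
rewrite (eigdec_trpow _ _ _ dM).
have -> : N%:R * (c%:R + y j) ^+ (2 * k) = \sum_(i < N) (c%:R + y j) ^+ (2 * k).
  by rewrite sumr_const card_ord mulr_natl.
apply: ler_sum => i _; rewrite mul1r lerXn2r ?nnegrE // lerD2l; exact: mx.
Qed.

End ShiftedTracePowers.

(** * Integrals of finite linear combinations *)

Section LinearCombinations.
Context d (T : measurableType d) (R : realType) (P : probability T R).
Implicit Types (c : R) (f g : T -> R).

Lemma integrableDR f g : P.-integrable setT (EFin \o f) ->
  P.-integrable setT (EFin \o g) -> P.-integrable setT (EFin \o (fun w => f w + g w)).
Proof. by move=> hf hg; have := integrableD measurableT hf hg. Qed.

Lemma integrableZR c f : P.-integrable setT (EFin \o f) ->
  P.-integrable setT (EFin \o (fun w => c * f w)).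
Proof. by move=> hf; have := integrableZl measurableT c hf. Qed.

Lemma integrable_lincomb (I : Type) (r : seq I) (c : I -> R) (f : I -> T -> R) :
  (forall i, P.-integrable setT (EFin \o f i)) ->
  P.-integrable setT (EFin \o (fun w => \sum_(i <- r) c i * f i w)).
Proof.
move=> hf; elim: r => [|i r IH].
  under [X in EFin \o X]eq_fun do rewrite big_nil.
  exact: finite_measure_integrable_cst.
under [X in EFin \o X]eq_fun do rewrite big_cons.
by apply: integrableDR => //; exact: integrableZR.
Qed.

Lemma Rintegral_lincomb (I : Type) (r : seq I) (c : I -> R) (f : I -> T -> R) :
  (forall i, P.-integrable setT (EFin \o f i)) ->
  \int[P]_w (\sum_(i <- r) c i * f i w) = \sum_(i <- r) c i * \int[P]_w (f i w).
Proof.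
move=> hf; elim: r => [|i r IH].
  under eq_Rintegral do rewrite big_nil.
  by rewrite big_nil Rintegral_cst // mul0r.
under eq_Rintegral do rewrite big_cons.
rewrite RintegralD ?RintegralZl ?IH ?big_cons //; first exact: integrableZR.
exact: integrable_lincomb.
Qed.

End LinearCombinations.

Lemma sum_even_terms (R : nmodType) (F : nat -> R) (K : nat) :
  (forall k, odd k -> F k = 0) -> \sum_(k < (2 * K).+1) F k = \sum_(t < K.+1) F (2 * t)%N.
Proof.
move=> F0; elim: K => [|K IH]; first by rewrite !big_ord_recr !big_ord0.
rewrite [RHS]big_ord_recr -IH /=.
have -> : (2 * K.+1 = (2 * K).+2)%N by lia.
rewrite 2!big_ord_recr /= [F (2 * K).+1]F0 ?addr0 //.
by rewrite mul2n /= odd_double.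
Qed.

(** * From moment bounds to tail bounds *)

Section TailFromMoments.
Context d (T : measurableType d) (R : realType) (P : probability T R) (N : nat).
Variable X : T -> 'M[R[i]]_N.
Hypothesis N_gt0 : (0 < N)%N.
Hypothesis X_herm : forall w, adj (X w) = X w.

Lemma measurable_lambda_max_ge (theta : R) : 0 <= theta ->
  (forall k, measurable_fun setT (fun w => Retr (X w ^+ k))) ->
  measurable [set w | theta <= lambda_max_mx (X w)].
Proof.
move=> t0 mX.
have -> : [set w | theta <= lambda_max_mx (X w)] =
  \bigcap_c \bigcap_k [set w | ((c%:R + theta) ^+ (2 * k) <= trpow (2 * k) 1 c%:R (X w))%R].
  apply/seteqP; split=> w /=.
    by move/(le_lambda_max_trpow N_gt0 (X_herm w) t0) => h c _ k _; exact: h.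
  move=> h; apply/(le_lambda_max_trpow N_gt0 (X_herm w) t0) => c k; exact: h.
apply: bigcap_measurable => // c _; apply: bigcap_measurable => // k _.
rewrite -[X in measurable X]setTI.
apply: measurable_fun_le => //; rewrite /trpow.
by apply: measurable_sum => j; exact: measurable_funM.
Qed.

Variable v : R.
Hypothesis X_int : forall k, P.-integrable setT (EFin \o (fun w => Retr (X w ^+ k))).
Hypothesis X_odd : forall k, odd k -> \int[P]_w (Retr (X w ^+ k)) = 0.
Hypothesis X_even : forall t,
  \int[P]_w (Retr (X w ^+ (2 * t))) <= (odd_fact t)%:R * v ^+ t * N%:R.
Hypothesis v_gt0 : 0 < v.

Lemma integrable_trpow m a b : P.-integrable setT (EFin \o (fun w => trpow m a b (X w))).
Proof. by apply: integrable_lincomb. Qed.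

Lemma expectation_trpow m a b : \int[P]_w (trpow m a b (X w)) =
  \sum_(k < m.+1) ('C(m, k)%:R * b ^+ (m - k) * a ^+ k) * \int[P]_w (Retr (X w ^+ k)).
Proof. by apply: Rintegral_lincomb. Qed.

(** Writing (2t)! = 2^t t! (2t-1)!! cancels the double factorial of the moment bound and leaves the
    term of order t in the exponential series of s^2 v / 2. *)
Lemma expectation_trpow_le (s : R) (K : nat) : 0 <= s -> (0 < K)%N ->
  \int[P]_w (trpow (2 * K) (s / (2 * K)%:R) 1 (X w)) <= N%:R * expR (s ^+ 2 * v / 2).
Proof.
move=> s0 K0; set m := (2 * K)%N; rewrite expectation_trpow.
pose F k := 'C(m, k)%:R * (s / m%:R) ^+ k * \int[P]_w (Retr (X w ^+ k)).
under eq_bigr do rewrite expr1n mulr1 -/(F _).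
rewrite sum_even_terms => [|k ok]; last by rewrite /F X_odd // mulr0.
apply: (@le_trans _ _ (N%:R * \sum_(t < K.+1) (s ^+ 2 * v / 2) ^+ t / t`!%:R)); last first.
  by rewrite ler_wpM2l // exp_partial_le // divr_ge0 // mulr_ge0 ?sqr_ge0 // ltW.
rewrite mulr_sumr; apply: ler_sum => t _; rewrite /F.
have v0 := ltW v_gt0.
have B0 : 0 <= (odd_fact t)%:R * v ^+ t * N%:R by rewrite !mulr_ge0 // exprn_ge0.
apply: (@le_trans _ _ (s ^+ (2 * t) / (2 * t)`!%:R * ((odd_fact t)%:R * v ^+ t * N%:R))).
  apply: (@le_trans _ _ ('C(m, 2 * t)%:R * (s / m%:R) ^+ (2 * t) *
      ((odd_fact t)%:R * v ^+ t * N%:R))).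
    by rewrite ler_wpM2l ?X_even // mulr_ge0 // exprn_ge0 // divr_ge0.
  by rewrite ler_wpM2r // bin_scaled_le // /m; lia.
have f0 : (odd_fact t)%:R != 0 :> R.
  by rewrite pnatr_eq0 -lt0n prodn_gt0 // => i; rewrite addn1.
have f1 : t`!%:R != 0 :> R by rewrite pnatr_eq0 -lt0n fact_gt0.
have f2 : 2 ^+ t != 0 :> R by rewrite expf_neq0 // pnatr_eq0.
rewrite fact_double !natrM natrX !exprMn exprVn exprM le_eqVlt; apply/orP; left.
by apply/eqP; rewrite expr2 exprMn; field; rewrite f0 f1 f2.
Qed.

Lemma lambda_max_markov (theta s : R) (K : nat) : 0 <= theta -> 0 <= s -> (0 < K)%N ->
  (P [set w | (theta <= lambda_max_mx (X w))%R] <=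
   (N%:R * expR (s ^+ 2 * v / 2) / (1 + s * theta / (2 * K)%:R) ^+ (2 * K))%:E)%E.
Proof.
move=> t0 s0 K0; set m := (2 * K)%N; set S := [set w | _].
have em : ~~ odd m by rewrite /m mul2n odd_double.
pose g w := trpow m (s / m%:R) 1 (X w).
have q0 : 0 < (1 + s * theta / m%:R) ^+ m.
  by rewrite exprn_gt0 // ltr_wpDr // divr_ge0 // mulr_ge0.
have mS : measurable S.
  apply: measurable_lambda_max_ge => // k.
  by apply/measurable_EFinP; exact: measurable_int (X_int k).
have gI : P.-integrable setT (EFin \o g) by exact: integrable_trpow.
have mg : measurable_fun setT (EFin \o g) by exact: measurable_int gI.
have g0 w : 0 <= g w by apply: trpow_even_ge0.
rewrite -[leLHS]fineK ?fin_num_measure // lee_fin ler_pdivlMr //.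
apply: le_trans (expectation_trpow_le s0 K0).
rewrite -lee_fin EFinM fineK ?fin_num_measure // /Rintegral fineK; last first.
  exact: integrable_fin_num gI.
rewrite [leLHS]muleC -integral_cst //.
apply: (@le_trans _ _ (\int[P]_(w in S) (g w)%:E)%E).
  apply: ge0_le_integral => //.
  - by move=> w _; rewrite lee_fin ltW.
  - exact: measurable_funTS mg.
  - move=> w Sw; rewrite lee_fin /g mulrAC; apply: trpow_ge => //.
    exact: divr_ge0.
apply: ge0_subset_integral => //.
by move=> w _; rewrite lee_fin.
Qed.

Lemma lambda_max_tail (theta : R) : 0 <= theta ->
  (P [set w | (theta <= lambda_max_mx (X w))%R] <=
   (N%:R * expR (- theta ^+ 2 / (2 * v)))%:E)%E.
Proof.
move=> t0; set S := [set w | _].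
have mS : measurable S.
  apply: measurable_lambda_max_ge => // k.
  by apply/measurable_EFinP; exact: measurable_int (X_int k).
rewrite -[leLHS]fineK ?fin_num_measure // lee_fin.
pose x := theta ^+ 2 / v.
have x0 : 0 <= x by rewrite divr_ge0 ?sqr_ge0 // ltW.
(* The lower bound for the polynomial of degree 2k loses x^2 / (2k) in the exponent; the cruder
   error x^2 / k also vanishes in the limit. *)
apply: (@le_expR_limit _ _ _ _ (x ^+ 2)); first by rewrite ltr0n.
move=> k k0.
(* The choice s = theta / v minimises s^2 v / 2 - s theta. *)
have s0 : 0 <= theta / v by rewrite divr_ge0 // ltW.
have := lambda_max_markov t0 s0 k0.
rewrite -/S -[X in (X <= _)%E]fineK ?fin_num_measure // lee_fin.
have -> : theta / v * theta = x by rewrite /x; ring.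
have -> : (theta / v) ^+ 2 * v / 2 = x / 2 by rewrite /x; field; rewrite gt_eqF.
move/le_trans; apply; rewrite -mulrA ler_wpM2l //.
have k2 : (0 < 2 * k)%N by lia.
have q0 : 0 < (1 + x / (2 * k)%:R) ^+ (2 * k).
  by rewrite exprn_gt0 // ltr_wpDr // divr_ge0.
rewrite ler_pdivrMr //.
apply: (@le_trans _ _ (expR (- theta ^+ 2 / (2 * v) + x ^+ 2 / k%:R) *
   expR (x - x ^+ 2 / (2 * k)%:R))); last first.
  by rewrite ler_wpM2l ?expR_ge0 // expR_le_pow.
rewrite -expRD ler_expR.
have -> : - theta ^+ 2 / (2 * v) = - x / 2 by rewrite /x; field; rewrite gt_eqF.
have -> : x ^+ 2 / (2 * k)%:R = x ^+ 2 / k%:R / 2.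
  by rewrite natrM; field; rewrite pnatr_eq0 -lt0n.
have : 0 <= x ^+ 2 / k%:R by rewrite divr_ge0 // sqr_ge0.
move: (_ / _) => z; lra.
Qed.

End TailFromMoments.

(** * Linear combinations of Hermitian matrices *)

Section MatrixSeries.
Context {R : realType} {N n : nat}.
Variable A : 'I_n -> 'M[R[i]]_N.
Hypothesis A_herm : forall i, adj (A i) = A i.
Implicit Types (M Y Z : 'M[R[i]]_N).

Definition mxcomb (a : 'I_n -> R) : 'M[R[i]]_N := \sum_i (a i)%:C%C *: A i.

Lemma mxcomb_herm a : adj (mxcomb a) = mxcomb a.
Proof.
have adj0 : adj (0 : 'M[R[i]]_N) = 0 by rewrite trmx0 map_mx0.
rewrite /mxcomb (big_morph (fun M : 'M[R[i]]_N => adj M) (@ctmxD R N N) adj0).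
by apply: eq_bigr => i _; rewrite ctmxZ A_herm.
Qed.

Lemma Retr_mxcombl a M : Retr (mxcomb a *m M) = \sum_i a i * Retr (A i *m M).
Proof.
rewrite /mxcomb mulmx_suml Retr_sum; apply: eq_bigr => i _ /=.
by rewrite -scalemxAl RetrZ.
Qed.

(** Adding the sum to its reversal under q -> 2t - q pairs each sandwich with its mirror image, to
    which [Retr_sandwich_le] applies. The factor 2t+1 is the number of terms. *)
Lemma Retr_sum_sandwich_le (B Y Z : 'M[R[i]]_N) (t : nat) :
  adj B = B -> adj Y = Y -> adj Z = Z ->
  2 * \sum_(q < (2 * t).+1) Retr (B *m Y ^+ (2 * t - q) *m B *m Z ^+ q) <=
  (2 * t + 1)%:R * (Retr (B *m B *m Y ^+ (2 * t)) + Retr (B *m B *m Z ^+ (2 * t))).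
Proof.
move=> hB hY hZ; set F := fun p q => Retr (B *m Y ^+ p *m B *m Z ^+ q).
have -> : 2 * \sum_(q < (2 * t).+1) F (2 * t - q)%N q =
    \sum_(q < (2 * t).+1) (F (2 * t - q)%N q + F q (2 * t - q)%N).
  rewrite big_split /= mulr_natl mulr2n; congr (_ + _).
  rewrite (reindex_inj rev_ord_inj); apply: eq_bigr => q _ /=.
  by rewrite subSS subKn // -ltnS.
have -> : (2 * t + 1)%:R * (Retr (B *m B *m Y ^+ (2 * t)) + Retr (B *m B *m Z ^+ (2 * t)))
   = \sum_(q < (2 * t).+1) (Retr (B *m B *m Y ^+ (2 * t)) + Retr (B *m B *m Z ^+ (2 * t))).
  by rewrite sumr_const card_ord mulr_natl addn1.
apply: ler_sum => q _.
have e : (2 * t - q + q = 2 * t)%N by rewrite subnK // -ltnS.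
have := @Retr_sandwich_le _ _ B Y Z (2 * t - q) q hB hY hZ; rewrite e; apply.
by rewrite mul2n odd_double.
Qed.

(** A telescoping sum that keeps [Y] on the left and [Z] on the right, as they need not commute; it
    is the discrete counterpart of differentiating a power. *)
Lemma subrXX_noncomm Y Z (k : nat) :
  Y ^+ k.+1 - Z ^+ k.+1 = \sum_(q < k.+1) Y ^+ (k - q) *m (Y - Z) *m Z ^+ q.
Proof.
elim: k => [|k IH].
  by rewrite big_ord_recr big_ord0 /= add0r subn0 mx_expr0 mul1mx mulmx1 !expr1.
rewrite big_ord_recr /= subnn mx_expr0 mul1mx.
have -> : \sum_(q < k.+1) Y ^+ (k.+1 - q) *m (Y - Z) *m Z ^+ q = Y *m (Y ^+ k.+1 - Z ^+ k.+1).
  rewrite IH mulmx_sumr; apply: eq_bigr => q _.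
  by rewrite subSn -1?ltnS // mx_exprS !mulmxA.
by rewrite mulmxBr mulmxBl -!mx_exprS addrA subrK.
Qed.

End MatrixSeries.

(** * Moment recursion over the sign cube *)

Section RademacherMoments.
Context {R : realType} {N n : nat}.
Variables (A : 'I_n -> 'M[R[i]]_N) (v : R).
Hypothesis A_herm : forall i, adj (A i) = A i.
Hypothesis A_var : forall Y (t : nat), adj Y = Y -> ~~ odd t ->
  Retr ((\sum_i A i *m A i) *m Y ^+ t) <= v * Retr (Y ^+ t).

Definition sgnv (s : {ffun 'I_n -> bool}) (i : 'I_n) : R := (-1) ^+ s i.

Definition flip (i : 'I_n) (s : {ffun 'I_n -> bool}) : {ffun 'I_n -> bool} :=
  [ffun j => (j == i) (+) s j].

Lemma flipK i : involutive (flip i).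
Proof. by move=> s; apply/ffunP => j; rewrite !ffunE addbA addbb. Qed.

Lemma mxcomb_flip i s :
  mxcomb A (sgnv s) - mxcomb A (sgnv (flip i s)) = (2 * sgnv s i)%:C%C *: A i.
Proof.
rewrite /mxcomb -sumrB (bigD1 i) //= big1 ?addr0 => [|j ji]; last first.
  by rewrite /sgnv ffunE (negbTE ji) /= subrr.
rewrite -scalerBl -rmorphB; congr ((_)%:C%C *: _).
by rewrite /sgnv ffunE eqxx; case: (s i); rewrite /= ?expr0 ?expr1; ring.
Qed.

(** Discrete integration by parts. Averaging the sum with its image under [flip i] leaves a
    difference of powers of X and its flip Y; as X - Y is twice the sign times [A i] and the sign
    squares to 1, telescoping produces sandwiches. Flip invariance then turns the traces of Y back
    into those of X. *)
Lemma rad_coord_le i (t : nat) :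
  \sum_s sgnv s i * Retr (A i *m mxcomb A (sgnv s) ^+ (2 * t).+1) <=
  (2 * t + 1)%:R * \sum_s Retr (A i *m A i *m mxcomb A (sgnv s) ^+ (2 * t)).
Proof.
pose X s := mxcomb A (sgnv s); pose Y s := X (flip i s).
have hX s : adj (X s) = X s by exact: mxcomb_herm.
have flip_sum (F : {ffun 'I_n -> bool} -> R) : \sum_s F (flip i s) = \sum_s F s.
  by rewrite [RHS](reindex_inj (inv_inj (flipK i))).
set L := \sum_s _; set Rs := \sum_s Retr (A i *m A i *m _).
have eL : 2 * L = \sum_s sgnv s i * Retr (A i *m (X s ^+ (2 * t).+1 - Y s ^+ (2 * t).+1)).
  rewrite mulr_natl mulr2n {2}/L -flip_sum -big_split; apply: eq_bigr => s _ /=.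
  rewrite mulmxBr RetrD RetrN mulrBr; congr (_ + _).
  by rewrite -mulNr; congr (_ * _); rewrite /sgnv ffunE eqxx; case: (s i); rewrite /= ?expr0 ?expr1 ?opprK.
have eS s : sgnv s i * Retr (A i *m (X s ^+ (2 * t).+1 - Y s ^+ (2 * t).+1)) =
    2 * \sum_(q < (2 * t).+1) Retr (A i *m X s ^+ (2 * t - q) *m A i *m Y s ^+ q).
  rewrite subrXX_noncomm mulmx_sumr Retr_sum !mulr_sumr; apply: eq_bigr => q _.
  rewrite mxcomb_flip /= -scalemxAr -scalemxAl -scalemxAr RetrZ !mulmxA mulrA.
  congr (_ * _); rewrite mulrCA /sgnv; case: (s i); rewrite /= ?expr0 ?expr1; ring.
have : 2 * L <= \sum_s (2 * t + 1)%:R *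
    (Retr (A i *m A i *m X s ^+ (2 * t)) + Retr (A i *m A i *m Y s ^+ (2 * t))).
  rewrite eL; apply: ler_sum => s _; rewrite eS; apply: Retr_sum_sandwich_le => //.
  exact: hX.
rewrite -mulr_sumr big_split /= (flip_sum (fun s => Retr (A i *m A i *m X s ^+ (2 * t)))).
rewrite -/Rs; lra.
Qed.

Lemma rad_even_step (t : nat) :
  \sum_s Retr (mxcomb A (sgnv s) ^+ (2 * t.+1)) <=
  (2 * t + 1)%:R * v * \sum_s Retr (mxcomb A (sgnv s) ^+ (2 * t)).
Proof.
have -> : (2 * t.+1 = (2 * t).+2)%N by lia.
under eq_bigr do rewrite mx_exprS Retr_mxcombl.
rewrite exchange_big /=.
apply: (@le_trans _ _ (\sum_i (2 * t + 1)%:R *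
    \sum_s Retr (A i *m A i *m mxcomb A (sgnv s) ^+ (2 * t)))).
  by apply: ler_sum => i _; exact: rad_coord_le.
rewrite -mulr_sumr -mulrA ler_wpM2l // exchange_big /= mulr_sumr.
apply: ler_sum => s _.
rewrite -Retr_sum -mulmx_suml; apply: A_var; first exact: mxcomb_herm.
by rewrite mul2n odd_double.
Qed.

Lemma rad_even (t : nat) : 0 <= v ->
  \sum_s Retr (mxcomb A (sgnv s) ^+ (2 * t)) <=
  (odd_fact t)%:R * v ^+ t * \sum_s Retr (mxcomb A (sgnv s) ^+ 0).
Proof.
move=> v0; elim: t => [|t IH].
  by rewrite muln0 expr0 mulr1 /odd_fact big_ord0 mul1r.
apply: le_trans (rad_even_step t) _.
apply: (le_trans (ler_wpM2l _ IH)); first by rewrite mulr_ge0.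
by rewrite odd_factS exprS natrM le_eqVlt; apply/orP; left; apply/eqP; ring.
Qed.

(** Reversing all signs at once turns X into -X. *)
Lemma rad_odd (k : nat) : odd k -> \sum_s Retr (mxcomb A (sgnv s) ^+ k) = 0.
Proof.
move=> ok; pose neg (s : {ffun 'I_n -> bool}) : {ffun 'I_n -> bool} := [ffun j => ~~ s j].
have negK : involutive neg by move=> s; apply/ffunP => j; rewrite !ffunE negbK.
have eN s : mxcomb A (sgnv (neg s)) = - mxcomb A (sgnv s).
  rewrite /mxcomb -sumrN; apply: eq_bigr => i _; rewrite -scaleNr -rmorphN /=.
  by rewrite /sgnv ffunE; case: (s i); rewrite /= ?expr0 ?expr1 ?opprK.
have : \sum_s Retr (mxcomb A (sgnv s) ^+ k) = - \sum_s Retr (mxcomb A (sgnv s) ^+ k).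
  rewrite {1}(reindex_inj (inv_inj negK)) -sumrN; apply: eq_bigr => s _.
  by rewrite eN exprNn -signr_odd ok expr1 mulN1r RetrN.
lra.
Qed.

End RademacherMoments.

(** * Expectations under the Rademacher law *)

Section RademacherExpectation.
Context d (T : measurableType d) (R : realType) (P : probability T R) (n : nat).
Variable alpha : 'I_n -> {RV P >-> R}.
Hypothesis alpha_indep : mutually_independent alpha.
Hypothesis alpha_rad : forall i, rademacher_rv (alpha i).

Let point w : 'I_n -> R := fun i => alpha i w.

(** Only the masses at 1 and -1 are given. On a cell the whole sign vector is fixed, and
    independence gives each cell mass 2^-n, so that together they have full measure. *)
Definition cell (s : {ffun 'I_n -> bool}) : set T :=
  \bigcap_i (alpha i @^-1` [set sgnv s i]).

Lemma cellP s w : cell s w <-> point w = sgnv s.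
Proof.
split=> [h|h i _ /=]; first by apply/funext => i; exact: (h i).
by rewrite -[LHS]/(point w i) h.
Qed.

Lemma measurable_cell s : measurable (cell s).
Proof.
apply: fin_bigcap_measurable => [|i _]; first exact: finite_finset.
by rewrite -[X in measurable X]setTI; exact: measurable_funP.
Qed.

Lemma prob_cell s : P (cell s) = ((2^-1) ^+ n)%:E.
Proof.
rewrite /cell (alpha_indep (B := fun i => [set sgnv s i])); last first.
  by move=> i; exact: measurable_set1.
under eq_bigr => i _.
  have -> : P (alpha i @^-1` [set sgnv s i]) = (2^-1)%:E.
    by have [h1 h2] := alpha_rad i; rewrite /sgnv; case: (s i); rewrite ?expr1 ?expr0.
  over.
by rewrite prodEFin prodr_const card_ord.
Qed.

Lemma sgnv_inj : injective (@sgnv R n).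
Proof.
move=> s s' e; apply/ffunP => i; have := congr1 (@^~ i) e; rewrite /sgnv.
by case: (s i); case: (s' i) => //=; rewrite ?expr0 ?expr1; lra.
Qed.

Let steps (f : ('I_n -> R) -> R) w : R := \sum_s f (sgnv s) * \1_(cell s) w.

Let iI s : P.-integrable setT (EFin \o \1_(cell s)).
Proof. by apply: integrable_indic; exact: measurable_cell. Qed.

Let steps_int f : P.-integrable setT (EFin \o steps f).
Proof. by apply: integrable_lincomb => s; exact: iI. Qed.

Let expectation_steps f : \int[P]_w steps f w = (2^-1) ^+ n * \sum_s f (sgnv s).
Proof.
rewrite Rintegral_lincomb // mulr_sumr; apply: eq_bigr => s _.
rewrite /Rintegral integral_indic //; last exact: measurable_cell.
by rewrite setIT -[X in fine X]/(P (cell s)) prob_cell mulrC.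
Qed.

Let steps_cell f s w : cell s w -> steps f w = f (point w).
Proof.
move=> /[dup] hs /cellP ws; rewrite /steps (bigD1 s) //= big1 => [|s' ss'].
  by rewrite addr0 indicE mem_set // mulr1 ws.
rewrite indicE memNset ?mulr0 // => /cellP; rewrite ws => /sgnv_inj e.
by rewrite e eqxx in ss'.
Qed.

Let cells := \bigcup_s cell s.

Let measurable_cells : measurable cells.
Proof.
apply: fin_bigcup_measurable => [|s _]; first exact: finite_finset.
exact: measurable_cell.
Qed.

Let prob_cells : P cells = 1%E.
Proof.
rewrite -[cells]setIT -integral_indic //.
(* For the constant 1, [steps] is the indicator of the union of the cells; its integral is 2^n times
   2^-n. *)
have -> : (\int[P]_x (\1_cells x)%:E)%E = (\int[P]_w (steps (fun=> 1) w)%:E)%E.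
  apply: eq_integral => w _; congr (_%:E); rewrite indicE.
  case: (pselect (cells w)) => [cw|ncw].
    by rewrite mem_set //; case: cw => s _ /(steps_cell (fun=> 1)) ->.
  rewrite memNset // /steps big1 // => s _; rewrite indicE memNset ?mulr0 // => cs.
  by apply: ncw; exists s.
rewrite -[LHS]fineK; last exact: integrable_fin_num (steps_int (fun=> 1)).
rewrite -/(Rintegral _ _ _) expectation_steps sumr_const card_ffun card_bool card_ord.
by rewrite natrX -exprMn mulVf ?expr1n // pnatr_eq0.
Qed.

Lemma rademacher_expectation (f : ('I_n -> R) -> R) :
  measurable_fun setT (f \o point) ->
  P.-integrable setT (EFin \o (f \o point)) /\
  \int[P]_w f (point w) = (2^-1) ^+ n * \sum_s f (sgnv s).
Proof.
move=> mf.
have mN : measurable (~` cells) by exact: measurableC.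
have PN : P (~` cells) = 0%E by rewrite probability_setC // prob_cells subee.
have mEf : measurable_fun setT (EFin \o (f \o point)) by apply/measurable_EFinP.
have e w : w \in setT `\` ~` cells -> (EFin \o steps f) w = (EFin \o (f \o point)) w.
  by rewrite inE => -[_]; rewrite /setC /= notK => -[s _] /(steps_cell f) /= ->.
have fI : P.-integrable setT (EFin \o (f \o point)).
  apply/(negligible_integrable mN) => //.
  apply: (eq_integrable _ (EFin \o steps f)) => //; first exact: measurableD.
  by apply: integrableS (steps_int f) => //; exact: measurableD.
split=> //; rewrite -expectation_steps /Rintegral.
rewrite (negligible_integral mN _ fI PN) // (negligible_integral mN _ (steps_int f) PN) //.
by congr fine; apply/esym/eq_integral.
Qed.

End RademacherExpectation.

(** * Change of variables with a weight *)

Section Disintegration.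
Import numFieldNormedType.Exports.
Import HBNNSimple.
Context d d' (T : measurableType d) (T' : measurableType d') (R : realType).
Variables (mu : {measure set T -> \bar R}) (phi : T -> T') (G : T -> R).
Variables (nu : {measure set T' -> \bar R}) (c : R).
Hypothesis phi_meas : measurable_fun setT phi.
Hypothesis G_meas : measurable_fun setT G.
Hypothesis G_ge0 : forall w, 0 <= G w.
Hypothesis G_indic : forall B : set T', measurable B ->
  (\int[mu]_w (G w * \1_B (phi w))%:E = c%:E * nu B)%E.

Let nnsfun_case (h : {nnsfun T' >-> R}) :
  (\int[mu]_w (G w * h (phi w))%:E = c%:E * \int[nu]_x (h x)%:E)%E.
Proof.
have mh y : measurable (h @^-1` [set y]) by [].
have mGh y : measurable_fun setT (fun w => G w * \1_(h @^-1` [set y]) (phi w)).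
  apply: measurable_funM => //; apply: measurableT_comp phi_meas.
  by apply: measurable_indic; exact: (mh y).
have Gh0 y w : 0 <= G w * \1_(h @^-1` [set y]) (phi w) by rewrite mulr_ge0.
have yGh0 y w : 0 <= y * (G w * \1_(h @^-1` [set y]) (phi w)).
  rewrite indicE; case: (boolP (phi w \in h @^-1` [set y])) => [|_].
    by rewrite inE /= => <-; rewrite mulr1 mulr_ge0.
  by rewrite !mulr0.
have E w : (G w * h (phi w))%:E =
    (\sum_(y \in range h) (y * (G w * \1_(h @^-1` [set y]) (phi w)))%:E)%E.
  rewrite [h (phi w)]fimfunE mulr_fsumr fsumEFin //; congr (_%:E).
  by apply: eq_fsbigr => y _; rewrite mulrCA.
under eq_integral do rewrite E.
rewrite ge0_integral_fsum //=; last 2 first.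
- by move=> y; apply/measurable_EFinP/measurable_funM.
- by move=> y w _; rewrite lee_fin.
rewrite integralT_nnsfun sintegralE ge0_mule_fsumr; last first.
  move=> y; have [y0|y0] := leP 0 y; first by rewrite mule_ge0.
  by rewrite preimage_nnfun0 // measure0 mule0.
apply: eq_fsbigr => y; rewrite inE => -[x _ <-].
under eq_integral do rewrite EFinM.
rewrite ge0_integralZl_EFin //; last 2 first.
- by move=> w _; rewrite lee_fin.
- by apply/measurable_EFinP.
by rewrite (G_indic (mh _)) [LHS]muleCA.
Qed.

(** [G_indic] says that the image under [phi] of the measure with density [G] is [c] times [nu].
    This passes to simple functions and, by monotone convergence, to nonnegative ones. It serves
    both to split off one independent factor and to integrate against the normal density. *)
Lemma ge0_integral_disintegration (f : T' -> R) : measurable_fun setT f ->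
  (forall x, 0 <= f x) ->
  (\int[mu]_w (G w * f (phi w))%:E = c%:E * \int[nu]_x (f x)%:E)%E.
Proof.
move=> mf f0.
have mEf : measurable_fun setT (EFin \o f) by exact/measurable_EFinP.
pose h := nnsfun_approx measurableT mEf.
have hcv x : (h n x)%:E @[n --> \oo] --> (f x)%:E.
  by apply: (cvg_nnsfun_approx measurableT mEf) => // y _; rewrite lee_fin.
have hnd x : {homo (fun n => (h n x)) : m n / (m <= n)%N >-> m <= n}.
  by move=> m n mn; exact/lefP/nd_nnsfun_approx.
have cv1 : (\int[mu]_w (G w * h n (phi w))%:E)%E @[n --> \oo] -->
    (\int[mu]_w (G w * f (phi w))%:E)%E.
  have -> : (\int[mu]_w (G w * f (phi w))%:E =
     \int[mu]_w (limn (fun n => (G w * h n (phi w))%:E)))%E.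
    apply: eq_integral => w _; apply/esym/cvg_lim => //.
    under eq_fun do rewrite EFinM.
    by rewrite EFinM; apply: cvgeZl.
  apply: (@cvg_monotone_convergence _ T R mu setT measurableT (fun n w => (G w * h n (phi w))%:E)).
  - move=> n; apply/measurable_EFinP/measurable_funM => //.
    exact: (measurableT_comp (measurable_funP (h n)) phi_meas).
  - by move=> n w _; rewrite lee_fin mulr_ge0.
  - by move=> w _ m n mn; rewrite lee_fin ler_wpM2l // hnd.
have cv2 : (\int[nu]_x (h n x)%:E)%E @[n --> \oo] --> (\int[nu]_x (f x)%:E)%E.
  have -> : (\int[nu]_x (f x)%:E = \int[nu]_x (limn (fun n => (h n x)%:E)))%E.
    by apply: eq_integral => w _; apply/esym/cvg_lim.
  apply: (@cvg_monotone_convergence _ _ R nu setT measurableT (fun n w => (h n w)%:E)).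
  - by move=> n; apply/measurable_EFinP.
  - by move=> n w _; rewrite lee_fin.
  - by move=> w _ m n mn; rewrite lee_fin hnd.
have cv3 : (\int[mu]_w (G w * h n (phi w))%:E)%E @[n --> \oo] -->
   (c%:E * \int[nu]_x (f x)%:E)%E.
  under eq_fun do rewrite nnsfun_case.
  exact: cvgeZl.
exact: cvg_unique cv1 cv3.
Qed.

End Disintegration.

(** * Expectations of products of independent variables *)

Section IndependentProducts.
Context d (T : measurableType d) (R : realType) (P : probability T R) (n : nat).
Variable alpha : 'I_n -> {RV P >-> R}.
Hypothesis alpha_indep : mutually_independent alpha.
Implicit Types (F : 'I_n -> R -> R).

Let m F i := \int[P]_w F i (alpha i w).
Let good F := (forall i, measurable_fun setT (F i)) /\
  forall i, P.-integrable setT (EFin \o (F i \o alpha i)).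

Definition upd F i f : 'I_n -> R -> R := fun j => if j == i then f else F j.

Lemma prod_upd F i f (g : ('I_n) -> (R -> R) -> R) :
  \prod_j g j (upd F i f j) = g i f * \prod_(j | j != i) g j (F j).
Proof.
rewrite (bigD1 i) //= /upd eqxx; congr (_ * _).
by apply: eq_bigr => j /negbTE ->.
Qed.

Let good_upd F i f : good F -> measurable_fun setT f ->
  P.-integrable setT (EFin \o (f \o alpha i)) -> good (upd F i f).
Proof.
by move=> [g1 g2] mf fI; split=> j; rewrite /upd; case: (eqVneq j i) => // ->.
Qed.

Let measurable_prod_alpha F (Q : pred 'I_n) : (forall i, measurable_fun setT (F i)) ->
  measurable_fun setT (fun w => \prod_(i | Q i) F i (alpha i w)).
Proof.
move=> mF; under eq_fun do rewrite -big_filter.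
apply: measurable_prod => i _.
exact: (measurableT_comp (mF i) (measurable_funP (alpha i))).
Qed.

Let measurable_preim i (B : set R) : measurable B -> measurable (alpha i @^-1` B).
Proof.
move=> mB; rewrite -[X in measurable X]setTI.
by apply: measurable_funP.
Qed.

Let int_indic i (B : set R) : measurable B ->
  ((\int[P]_w (\1_B (alpha i w)))%:E = P (alpha i @^-1` B))%E.
Proof.
move=> mB; have mA := measurable_preim i mB.
have -> : \int[P]_w (\1_B (alpha i w)) = \int[P]_w (\1_(alpha i @^-1` B) w) by [].
by rewrite /Rintegral integral_indic // setIT fineK // fin_num_measure.
Qed.

Lemma indep_prod_indic (B : 'I_n -> set R) : (forall i, measurable (B i)) ->
  (\int[P]_w (\prod_i (\1_(B i) (alpha i w) : R))%:E =
   (\prod_i \int[P]_w (\1_(B i) (alpha i w)))%:E)%E.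
Proof.
move=> mB; have mA i := measurable_preim i (mB i).
have e w : \prod_i (\1_(B i) (alpha i w) : R) = \1_(\bigcap_i (alpha i @^-1` B i)) w.
  rewrite indicE; case: (pselect ((\bigcap_i (alpha i @^-1` B i)) w)) => h.
    rewrite mem_set // big1 // => i _; rewrite indicE mem_set //; exact: h.
  rewrite memNset //.
  have [i hi] : exists i, ~ B i (alpha i w).
    by apply: contrapT => /forallNP h'; apply: h => i _; exact: contrapT (h' i).
  by rewrite (bigD1 i) //= indicE memNset // mul0r.
under eq_integral do rewrite e.
rewrite integral_indic //; last first.
  by apply: fin_bigcap_measurable => //; exact: finite_finset.
rewrite setIT -[LHS]/(P _) (alpha_indep mB) -prodEFin; apply: eq_bigr => i _.
by rewrite int_indic.
Qed.

(** Independence is known for sets, that is, when all factors are indicators. The list [s] holds the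
    indices where the factor may be something else, and the induction frees one factor at a time. *)
Lemma indep_prod_ge0 (s : seq 'I_n) F : good F -> (forall i x, 0 <= F i x) ->
  (forall i, i \notin s -> exists2 B : set R, measurable B & F i = \1_B) ->
  (\int[P]_w (\prod_i F i (alpha i w))%:E = (\prod_i m F i)%:E)%E.
Proof.
elim: s F => [|i s IH] F gF F0 Find.
  have /choice[B hB] : forall i, exists B : set R, measurable B /\ F i = \1_B.
    by move=> i; have [//|B mB ->] := Find i; exists B.
  have e w : (\prod_i F i (alpha i w))%:E = (\prod_i (\1_(B i) (alpha i w) : R))%:E.
    by congr (_%:E); apply: eq_bigr => i _; rewrite (hB i).2.
  under eq_integral do rewrite e.
  rewrite indep_prod_indic; last by move=> i; have [] := hB i.
  by congr (_%:E); apply: eq_bigr => i _; rewrite /m (hB i).2.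
have [mF FI] := gF.
pose G w := \prod_(j | j != i) F j (alpha j w).
pose c := \prod_(j | j != i) m F j.
(* With factor [i] replaced by an indicator the induction hypothesis applies; this is the premise of
   the disintegration for [alpha i], weighted by the other factors. *)
have key : forall B : set R, measurable B ->
  (\int[P]_w (G w * \1_B (alpha i w))%:E = c%:E * distribution P (alpha i) B)%E.
  move=> B mB.
  have mA := measurable_preim i mB.
  have iB : P.-integrable setT (EFin \o (\1_B \o alpha i)).
    by have := integrable_indic P mA.
  have e w : (G w * \1_B (alpha i w))%:E = (\prod_j upd F i (\1_B) j (alpha j w))%:E.
    by rewrite (prod_upd F i _ (fun j f => f (alpha j w))) mulrC.
  under eq_integral do rewrite e.
  rewrite IH.
  - rewrite (prod_upd F i (\1_B) (fun j f => \int[P]_w f (alpha j w))) mulrC EFinM.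
    by rewrite int_indic.
  - by apply: good_upd => //; exact: measurable_indic.
  - by move=> j x; rewrite /upd; case: eqP.
  - move=> j js; rewrite /upd; case: eqVneq => [_|ji]; first by exists B.
    by apply: Find; rewrite inE negb_or ji.
have mG : measurable_fun setT G by exact: measurable_prod_alpha.
have G0 w : 0 <= G w by apply: prodr_ge0.
transitivity (\int[P]_w (G w * F i (alpha i w))%:E)%E.
  by apply: eq_integral => w _; rewrite (bigD1 i) //= mulrC.
rewrite (ge0_integral_disintegration (nu := distribution P (alpha i))
  (measurable_funP (alpha i)) mG G0 key (mF i) (F0 i)).
rewrite ge0_integral_distribution //; last 2 first.
- by apply/measurable_EFinP.
- by move=> y; rewrite lee_fin.
rewrite [in RHS](bigD1 i) //= mulrC EFinM; congr (_ * _)%E.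
by rewrite /m /Rintegral fineK //; exact: integrable_fin_num (FI i).
Qed.

Let good_abs F : good F -> good (fun i x => `|F i x|).
Proof.
move=> [mF FI]; split=> i.
  exact: (measurableT_comp (@measurable_realfun.normr_measurable R setT) (mF i)).
exact: (integrable_norm (FI i)).
Qed.

Lemma indep_prod_integrable F : good F ->
  P.-integrable setT (EFin \o (fun w => \prod_i F i (alpha i w))).
Proof.
move=> gF; have [mF FI] := gF.
have mprod : measurable_fun setT (fun w => \prod_i F i (alpha i w)).
  exact: measurable_prod_alpha.
apply/integrableP; split; first exact/measurable_EFinP.
have e w : abse ((EFin \o (fun w => \prod_i F i (alpha i w))) w) =
    (\prod_i `|F i (alpha i w)|)%:E by rewrite /= normr_prod.
under eq_integral do rewrite e.
rewrite (@indep_prod_ge0 (enum 'I_n) (fun i x => `|F i x|)) ?ltry //.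
- exact: good_abs.
- by move=> i; rewrite mem_enum.
Qed.

(** Here [s] lists the indices whose factor may change sign. Such a factor is written as (F + |F|) -
    |F|, a difference of nonnegative functions, and both sides are linear in it. *)
Lemma indep_prod F : good F ->
  \int[P]_w (\prod_i F i (alpha i w)) = \prod_i m F i.
Proof.
move=> gF; suff H : forall (s : seq 'I_n) F', good F' ->
    (forall i, i \notin s -> forall x, 0 <= F' i x) ->
    \int[P]_w (\prod_i F' i (alpha i w)) = \prod_i m F' i.
  by apply: (H (enum 'I_n)) => // i; rewrite mem_enum.
move=> {gF F}; elim=> [|i s IH] F gF F0.
  rewrite /Rintegral (@indep_prod_ge0 (enum 'I_n)) // => i => [x|].
    exact: F0.
  by rewrite mem_enum.
have [mF FI] := gF; have [maF aFI] := good_abs gF.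
pose f1 x := F i x + `|F i x|; pose f2 x := `|F i x|.
have f1_ge0 x : 0 <= f1 x by rewrite /f1; have := ler_norm (- F i x); rewrite normrN; lra.
have g1 : good (upd F i f1).
  by apply: good_upd => //; [exact: measurable_funD|exact: (integrableDR (FI i) (aFI i))].
have g2 : good (upd F i f2) by apply: good_upd => //; [exact: maF i|exact: aFI i].
have upd0 f : (forall x, 0 <= f x) -> forall j, j \notin s -> forall x, 0 <= upd F i f j x.
  move=> f0 j js x; rewrite /upd; case: eqVneq => // ji.
  by apply: F0; rewrite inE negb_or ji.
have split w : \prod_j F j (alpha j w) =
    \prod_j upd F i f1 j (alpha j w) - \prod_j upd F i f2 j (alpha j w).
  rewrite !(prod_upd F i _ (fun j f => f (alpha j w))) -mulrBl /f1 /f2 addrK.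
  by rewrite (bigD1 i).
under eq_Rintegral do rewrite split.
rewrite (RintegralB measurableT (indep_prod_integrable g1) (indep_prod_integrable g2)).
rewrite (IH _ g1 (upd0 _ f1_ge0)) (IH _ g2 (upd0 _ (fun x => normr_ge0 _))).
rewrite /m !(prod_upd F i _ (fun j f => \int[P]_w f (alpha j w))) -mulrBl.
rewrite [in RHS](bigD1 i) //=; congr (_ * _).
have e : \int[P]_w f1 (alpha i w) = \int[P]_w F i (alpha i w) + \int[P]_w f2 (alpha i w).
  exact: (RintegralD measurableT (FI i) (aFI i)).
by rewrite e addrK.
Qed.

End IndependentProducts.

(** * Moments of the standard normal law *)

Section GaussianMoments.
Import numFieldNormedType.Exports.
Context {R : realType}.
Local Notation mu := (@lebesgue_measure R).
Local Notation phi := (@normal_pdf R 0 1).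

Lemma std_normal_pdfE x : phi x = normal_peak 1 * expR (- (x ^+ 2 / 2)).
Proof.
by rewrite normal_pdfE ?oner_neq0 // /normal_fun subr0 expr1n mulNr.
Qed.

Lemma is_derive_std_normal_pdf x : is_derive x (1 : R) phi (- x * phi x).
Proof.
have -> : phi = fun x => normal_peak 1 * expR (- (x ^+ 2 / 2)).
  by apply/funext => y; exact: std_normal_pdfE.
by apply: is_derive_eq; rewrite /GRing.scale /=; field.
Qed.

Lemma is_derive_pow_pdf k x : is_derive x (1 : R) (fun x => - (x ^+ k.+1 * phi x))
  (x ^+ k.+2 * phi x - k.+1%:R * (x ^+ k * phi x)).
Proof.
have h := is_derive_std_normal_pdf x.
have hX : is_derive x (1 : R) (fun y : R => y ^+ k.+1) (k.+1%:R * x ^+ k).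
  by have := is_deriveX k.+1 (is_derive_id x (1:R)); rewrite exprfctE /GRing.scale /= mulr1.
apply: (is_derive_eq (is_deriveN (is_deriveM hX h))).
by rewrite /GRing.scale /= !exprS; ring.
Qed.

Lemma continuous_pow_pdf k : continuous (fun x : R => x ^+ k * phi x).
Proof.
move=> x; apply: cvgM; first exact: exprn_continuous.
exact: continuous_normal_pdf.
Qed.

(** Moments truncated to a compact interval, where the fundamental theorem of calculus gives the
    recursion with a boundary term; [n.+1] keeps the interval nondegenerate. *)
Let a (k n : nat) : R := \int[mu]_(x in `[0, n.+1%:R]) (x ^+ k * phi x).

Let h_int k n : mu.-integrable `[0, n.+1%:R] (EFin \o (fun x : R => x ^+ k * phi x)).
Proof.
apply: continuous_compact_integrable; first exact: segment_compact.
by apply: continuous_subspaceT => x; exact: continuous_pow_pdf.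
Qed.

Let a_rec k n : a k.+2 n = k.+1%:R * a k n - n.+1%:R ^+ k.+1 * phi n.+1%:R.
Proof.
have n0 : (0 : R) < n.+1%:R by rewrite ltr0n.
pose f x : R := x ^+ k.+2 * phi x - k.+1%:R * (x ^+ k * phi x).
pose F x : R := - (x ^+ k.+1 * phi x).
have dF x : is_derive x (1 : R) F (f x) := is_derive_pow_pdf k x.
have cF : continuous F.
  by move=> x; apply: cvgN; exact: (continuous_pow_pdf (k := k.+1)).
have cf : continuous f.
  move=> x; apply: cvgB; first exact: (continuous_pow_pdf (k := k.+2)).
  by apply: cvgMr; exact: (continuous_pow_pdf (k := k)).
have FTC : (\int[mu]_(x in `[0%R, n.+1%:R]) (f x)%:E = (F n.+1%:R)%:E - (F 0)%:E)%E.
  apply: continuous_FTC2 => //.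
  - by apply: continuous_subspaceT => x; exact: cf.
  - split.
    + by move=> x _; have [] := dF x.
    + exact/cvg_at_right_filter/cF.
    + exact/cvg_at_left_filter/cF.
  - by move=> x _; rewrite derive1E; have [_ ->] := dF x.
have : \int[mu]_(x in `[0, n.+1%:R]) f x = F n.+1%:R.
  have F0 : F 0 = 0 by rewrite /F expr0n /= mul0r oppr0.
  by rewrite /Rintegral FTC F0 -EFinB subr0.
rewrite RintegralB //; last exact: (integrableZl _ _ (h_int k n)).
rewrite RintegralZl // -/(a _ _) -/(a _ _) /F => /eqP.
by rewrite subr_eq addrC => /eqP ->.
Qed.

Let tail_cvg0 k : (n.+1%:R ^+ k.+1 * phi n.+1%:R : R) @[n --> \oo] --> (0 : R).
Proof.
(* From exp(N^2/2) >= (N^2/2)^(k+1) / (k+1)! one gets N^(k+1) exp(-N^2/2) <= 2^(k+1) (k+1)! / N for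
   N >= 1; [C] also carries the peak of the density. *)
pose C : R := normal_peak 1 * (2 ^+ k.+1 * k.+1`!%:R).
apply: (@squeeze_cvgr _ _ _ _ (fun=> 0) (fun n => C * harmonic n)); last 2 first.
- exact: cvg_cst.
- by rewrite -[X in _ --> X](mulr0 C); apply: cvgMr; exact: cvg_harmonic.
apply: nearW => n; rewrite std_normal_pdfE.
have p0 : 0 <= normal_peak (1 : R) by exact: normal_peak_ge0.
apply/andP; split; first by rewrite !mulr_ge0 ?exprn_ge0 ?expR_ge0.
rewrite /C [leLHS]mulrCA -[leRHS]mulrA ler_wpM2l //.
set N : R := n.+1%:R; have N0 : 0 < N by rewrite ltr0n.
have N1 : 1 <= N by rewrite ler1n.
have x0 : 0 <= N ^+ 2 / 2 by rewrite divr_ge0 // exprn_ge0 // ltW.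
have := expR_ge1Dxn k x0; set e := expR _ => he.
have e0 : 0 < e by exact: expR_gt0.
rewrite expRN -/e ler_pdivrMr // -[X in X <= _]mulr1.
have f0 : 0 < k.+1`!%:R :> R by rewrite ltr0n fact_gt0.
have le1 : (N ^+ 2 / 2) ^+ k.+1 / k.+1`!%:R <= e by apply: le_trans he; rewrite lerDr.
have : (2 ^+ k.+1 * k.+1`!%:R) * harmonic n * ((N ^+ 2 / 2) ^+ k.+1 / k.+1`!%:R) <=
       (2 ^+ k.+1 * k.+1`!%:R) * harmonic n * e.
  by rewrite ler_wpM2l // !mulr_ge0 ?exprn_ge0 ?invr_ge0 // ltW.
apply: le_trans.
have -> : 2 ^+ k.+1 * k.+1`!%:R * harmonic n * ((N ^+ 2 / 2) ^+ k.+1 / k.+1`!%:R) =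
   N ^+ k.+1 * (N ^+ k.+1 / N).
  rewrite /harmonic /= -/N expr_div_n -exprM mulnC exprM expr2.
  by field; rewrite !gt_eqF ?exprn_gt0.
rewrite ler_wpM2l ?exprn_ge0 ?(ltW N0) // exprS mulrAC divff ?mul1r ?gt_eqF //.
exact: exprn_ege1.
Qed.

Let h_ge0 t x : 0 <= x ^+ (2 * t) * phi x.
Proof. by rewrite mulr_ge0 ?normal_pdf_ge0 // exprn_even_ge0 // mul2n odd_double. Qed.

Let J t := (\int[mu]_(x in `[0%R, +oo[) (x ^+ (2 * t) * phi x)%:E)%E.

Let integralT_even t : (\int[mu]_x (x ^+ (2 * t) * phi x)%:E = 2%:E * J t)%E.
Proof.
rewrite ge0_symfun_integralT.
- by rewrite /J set_itvcy.
- by move=> x; exact: h_ge0.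
- exact: continuous_pow_pdf.
- move=> x /=; rewrite !std_normal_pdfE sqrrN exprNn -signr_odd mul2n odd_double.
  by rewrite expr0 mul1r.
Qed.

Let a_cvg t : (a (2 * t) n)%:E @[n --> \oo] --> J t.
Proof.
have e n : (a (2 * t) n)%:E = (\int[mu]_(x in `[0%R, n.+1%:R]) (x ^+ (2 * t) * phi x)%:E)%E.
  by rewrite /a /Rintegral fineK //; exact: integrable_fin_num (h_int _ _).
under eq_fun do rewrite e.
have mh : measurable_fun setT (fun x : R => x ^+ (2 * t) * phi x).
  by apply: continuous_measurable_fun; exact: continuous_pow_pdf.
have := ge0_cvgn_integral (mu := mu) (h_ge0 t) mh.
by rewrite -cvg_shiftS.
Qed.

Let J_val t : J t = ((odd_fact t)%:R / 2)%:E.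
Proof.
elim: t => [|t IH].
  have := integralT_even 0; rewrite /J muln0.
  under eq_integral do rewrite expr0 mul1r.
  rewrite integral_normal_pdf; under eq_integral do rewrite expr0 mul1r.
  (* Twice this integral is the total mass 1, which excludes infinite values. *)
  move: (\int[mu]_(x in _) _)%E => [r||] //; last first.
  - by rewrite gt0_muleNy // lte_fin.
  - by rewrite gt0_muley // lte_fin.
  rewrite -EFinM => -[h]; congr (_%:E); rewrite /odd_fact big_ord0; lra.
have cv : (a (2 * t.+1) n)%:E @[n --> \oo] --> ((odd_fact t.+1)%:R / 2)%:E.
  apply/cvg_EFin; first by apply: nearW.
  have e n : a (2 * t.+1) n =
      (2 * t).+1%:R * a (2 * t) n - n.+1%:R ^+ (2 * t).+1 * phi n.+1%:R.
    by rewrite -a_rec; congr (a _ n); lia.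
  have -> : (odd_fact t.+1)%:R / 2 = (2 * t).+1%:R * ((odd_fact t)%:R / 2) - 0 :> R.
    by rewrite odd_factS natrM addn1; field.
  rewrite (_ : fine \o _ = fun n => (2 * t).+1%:R * a (2 * t) n -
     n.+1%:R ^+ (2 * t).+1 * phi n.+1%:R); last by apply/funext => n /=.
  apply: cvgB; last exact: tail_cvg0.
  apply: cvgMr.
  by have := @a_cvg t; rewrite IH => /fine_cvg.
exact: cvg_unique (@a_cvg t.+1) cv.
Qed.

Lemma integral_even_pow_pdf t :
  (\int[mu]_x (phi x * x ^+ (2 * t))%:E = (odd_fact t)%:R%:E)%E.
Proof.
under eq_integral do rewrite mulrC.
by rewrite integralT_even J_val -EFinM mulrC divfK.
Qed.

Section NormalVariable.
Context d (T : measurableType d) (P : probability T R) (X : {RV P >-> R}).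
Hypothesis X_normal : standard_normal_rv X.

Lemma normal_expectation_ge0 (f : R -> R) : measurable_fun setT f ->
  (forall x, 0 <= f x) ->
  (\int[P]_w (f (X w))%:E = \int[mu]_x (phi x * f x)%:E)%E.
Proof.
move=> mf f0.
rewrite (@ge0_integral_disintegration _ _ (measurableTypeR R) R R mu id phi (distribution P X) 1) //.
- by rewrite mul1e ge0_integral_distribution //; exact/measurable_EFinP.
- exact: measurable_normal_pdf.
- exact: normal_pdf_ge0.
move=> B mB; rewrite mul1e -[RHS]/(distribution P X B) X_normal // /normal_prob [RHS]integral_mkcond.
apply: eq_integral => x _; rewrite patchE indicE.
by case: ifPn => _; rewrite ?mulr1 ?mulr0.
Qed.

Lemma normal_even_moment t : (\int[P]_w (X w ^+ (2 * t))%:E = (odd_fact t)%:R%:E)%E.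
Proof.
rewrite (normal_expectation_ge0 (f := fun x => x ^+ (2 * t))).
- exact: integral_even_pow_pdf.
- exact: exprn_measurable.
- by move=> x; rewrite exprn_even_ge0 // mul2n odd_double.
Qed.

Lemma normal_pow_integrable k : P.-integrable setT (EFin \o (fun w => X w ^+ k)).
Proof.
have mX j : measurable_fun setT (fun w => X w ^+ j).
  by apply: measurable_funX; exact: measurable_funP.
have evI t : P.-integrable setT (EFin \o (fun w => X w ^+ (2 * t))).
  apply/integrableP; split; first exact/measurable_EFinP.
  have e w : abse ((EFin \o (fun w => X w ^+ (2 * t))) w) = (X w ^+ (2 * t))%:E.
    by rewrite /= ger0_norm // exprn_even_ge0 // mul2n odd_double.
  by under eq_integral do rewrite e; rewrite normal_even_moment ltry.
(* Domination by 1 + y^2 with y = X^k, whose terms are even moments. *)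
apply: (@le_integrable _ _ _ P setT measurableT _
   (EFin \o (fun w => X w ^+ (2 * 0) + X w ^+ (2 * k)))).
- exact/measurable_EFinP.
- move=> w _ /=; rewrite lee_fin muln0 expr0 (mulnC 2) exprM.
  set y := X w ^+ k; have y2 := sqr_ge0 y; have ny := normr_ge0 y.
  rewrite [leRHS]ger0_norm; last lra.
  by rewrite -real_normK ?num_real //; nra.
- exact: integrableDR.
Qed.

(** The symmetry of the density is applied to the nonnegative function |x|^k + x^k, whose reflection
    is |x|^k - x^k; equal integrals force the odd moment to vanish. *)
Lemma normal_odd_moment k : odd k -> \int[P]_w (X w ^+ k) = 0.
Proof.
move=> ok; pose f (x : R) := `|x| ^+ k + x ^+ k.
have mk : measurable_fun setT (fun x : R => x ^+ k) by exact: exprn_measurable.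
have mf : measurable_fun setT f.
  by apply: measurable_funD => //; apply: measurable_funX; exact: normr_measurable.
have f0 x : 0 <= f x.
  by rewrite /f -normrX; have := ler_norm (- x ^+ k); rewrite normrN; lra.
have fN x : f (- x) = `|x| ^+ k - x ^+ k.
  by rewrite /f normrN exprNn -signr_odd ok expr1 mulN1r.
have mfN : measurable_fun setT (f \o -%R).
  by apply: measurableT_comp.
have XI := normal_pow_integrable k.
have aI : P.-integrable setT (EFin \o (fun w => `|X w| ^+ k)).
  have -> : (fun w => `|X w| ^+ k) = Num.norm \o (fun w => X w ^+ k).
    by apply/funext => w /=; rewrite normrX.
  exact: integrable_norm XI.
have : \int[P]_w f (X w) = \int[P]_w f (- X w).
  rewrite /Rintegral (normal_expectation_ge0 mf f0) (normal_expectation_ge0 mfN (fun x => f0 (- x))).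
  congr fine.
  have mg : measurable_fun setT (fun x => (phi x * f x)%:E).
    by apply/measurable_EFinP/measurable_funM => //; exact: measurable_normal_pdf.
  transitivity (\int[pushforward mu (-%R : _ -> measurableTypeR R)]_x (phi x * f x)%:E)%E.
    by apply: eq_measure_integral => //= B mB _; exact/esym/lebesgue_measureN.
  rewrite ge0_integral_pushforward //=; last first.
    by move=> x _; rewrite lee_fin mulr_ge0 // normal_pdf_ge0.
  by apply: eq_integral => x _ /=; rewrite !std_normal_pdfE sqrrN.
have -> : \int[P]_w f (- X w) = \int[P]_w (`|X w| ^+ k - X w ^+ k).
  by apply: eq_Rintegral => w _; exact: fN.
by rewrite /f RintegralD // RintegralB //; lra.
Qed.

End NormalVariable.

End GaussianMoments.

(** * Measurability of trace powers *)

Section MeasurableTracePowers.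
Context d (T : measurableType d) {R : realType} {N n : nat}.
Variables (A : 'I_n -> 'M[R[i]]_N) (a : T -> 'I_n -> R).

(** The freed [A l] is absorbed into the prefix [C], so powers can be expanded one factor at a time
    by inductions over all [C]. *)
Lemma Retr_mul_mxcomb (b : 'I_n -> R) (C F : 'M[R[i]]_N) :
  Retr (C *m (mxcomb A b *m F)) = \sum_l b l * Retr (C *m A l *m F).
Proof.
rewrite mulmxA mxtrace_mulC mulmxA /mxcomb mulmx_sumr Retr_sum; apply: eq_bigr => l _.
by rewrite -scalemxAr RetrZ -mulmxA mxtrace_mulC.
Qed.

Lemma measurable_Retr_pow (C : 'M[R[i]]_N) k : (forall l, measurable_fun setT (a ^~ l)) ->
  measurable_fun setT (fun w => Retr (C *m mxcomb A (a w) ^+ k)).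
Proof.
move=> ma; elim: k C => [|k IH] C.
  by under eq_fun do rewrite mx_expr0 mulmx1; exact: measurable_cst.
under eq_fun do rewrite mx_exprS Retr_mul_mxcomb.
by apply: measurable_sum => l; apply: measurable_funM.
Qed.

End MeasurableTracePowers.

(** * Gaussian integration by parts for monomials *)

Section GaussianSteinIdentity.
Context d (T : measurableType d) (R : realType) (P : probability T R) (n : nat).
Variable alpha : 'I_n -> {RV P >-> R}.
Hypothesis alpha_indep : mutually_independent alpha.
Hypothesis alpha_normal : forall i, standard_normal_rv (alpha i).

(** Encoded as words: multiplying by a variable is a cons, and the derivative in coordinate [i] is
    [count_mem i u] times the monomial of [rem i u]. *)
Definition monomial (u : seq 'I_n) w : R := \prod_(l <- u) alpha l w.

Let M i k := \int[P]_w (alpha i w ^+ k).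

Let M_rec i k : M i k.+2 = k.+1%:R * M i k.
Proof.
have ev t : M i (2 * t) = (odd_fact t)%:R.
  by rewrite /M /Rintegral (normal_even_moment (alpha_normal i)).
case: (boolP (odd k)) => [ok|ek].
  by rewrite /M !(normal_odd_moment (alpha_normal i)) ?mulr0 //= negbK.
have [t ->] : exists t, k = (2 * t)%N by exists k./2; lia.
have -> : (2 * t).+2 = (2 * t.+1)%N by lia.
by rewrite !ev odd_factS natrM mulrC addn1.
Qed.

Let M1 i : M i 1 = 0.
Proof. exact: (normal_odd_moment (alpha_normal i)). Qed.

Lemma mon_count u w : monomial u w = \prod_i alpha i w ^+ count_mem i u.
Proof.
elim: u => [|l u IH].
  by rewrite /monomial big_nil big1 // => i _; rewrite expr0.
rewrite /monomial big_cons -/(monomial u w) IH (bigD1 l) //= [RHS](bigD1 l) //= eqxx exprS mulrA.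
congr (_ * _); apply: eq_bigr => i il.
by rewrite eq_sym (negbTE il).
Qed.

Let pow_good (c : 'I_n -> nat) :
  (forall i, measurable_fun setT (fun x : R => x ^+ c i)) /\
  forall i, P.-integrable setT (EFin \o ((fun x : R => x ^+ c i) \o alpha i)).
Proof.
split=> i; first exact: exprn_measurable.
exact: (normal_pow_integrable (alpha_normal i)).
Qed.

Lemma mon_integrable u : P.-integrable setT (EFin \o monomial u).
Proof.
have := indep_prod_integrable alpha_indep (pow_good (fun i => count_mem i u)).
by under eq_fun do rewrite -mon_count.
Qed.

Lemma mon_expectation u : \int[P]_w monomial u w = \prod_i M i (count_mem i u).
Proof.
under eq_Rintegral do rewrite mon_count.
exact: (indep_prod alpha_indep (pow_good (fun i => count_mem i u))).
Qed.

(** Independence factors both sides into scalar moments; they differ only at [i], where the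
    recursion [M_rec] applies, or the vanishing mean if [i] is absent from [u]. *)
Lemma mon_stein i u : \int[P]_w (alpha i w * monomial u w) =
  (count_mem i u)%:R * \int[P]_w monomial (rem i u) w.
Proof.
have -> : (fun w => alpha i w * monomial u w) = monomial (i :: u).
  by apply/funext => w; rewrite /monomial big_cons.
rewrite !mon_expectation (bigD1 i) //= eqxx add1n.
have [iu|iu] := boolP (i \in u); last first.
  have c0 : count_mem i u = 0%N by apply/count_memPn.
  by rewrite c0 M1 !mul0r.
rewrite [in RHS](bigD1 i) //= mulrA.
have c1 j : count_mem j (rem i u) = (count_mem j u - (j == i))%N.
  by rewrite count_rem iu /= eq_sym.
congr (_ * _); last first.
  by apply: eq_bigr => j ji; rewrite c1 eq_sym (negbTE ji) subn0 add0n.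
rewrite c1 eqxx; have : (0 < count_mem i u)%N by rewrite -has_count has_pred1.
by case: (count_mem i u) => // c _; rewrite M_rec subn1.
Qed.

(** The Stein identity removes two letters at a time, so parity is preserved. *)
Lemma mon_odd u : odd (size u) -> \int[P]_w monomial u w = 0.
Proof.
have [k] := ubnP (size u); elim: k u => // k IH [|i u] //= su ou.
have -> : monomial (i :: u) = (fun w => alpha i w * monomial u w).
  by apply/funext => w; rewrite /monomial big_cons.
rewrite mon_stein; have [iu|iu] := boolP (i \in u); last first.
  by have -> : count_mem i u = 0%N; [apply/count_memPn | rewrite mul0r].
have sr := size_rem iu; have u0 : (0 < size u)%N by case: (u) iu.
have o : odd (size (rem i u)).
  by rewrite sr; move: ou u0; case: (size u) => //= s; rewrite negbK.
by rewrite IH ?mulr0 // sr; case: (size u) u0 su => //= s _; rewrite ltnS; exact: ltnW.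
Qed.

(** The product rule for the derivative in coordinate [i]. *)
Lemma dmon_cons i l u w :
  (count_mem i (l :: u))%:R * monomial (rem i (l :: u)) w =
  (l == i)%:R * monomial u w + alpha l w * ((count_mem i u)%:R * monomial (rem i u) w).
Proof.
rewrite /=; case: eqVneq => [->|li]; last first.
  by rewrite /monomial big_cons mul0r add0r add0n mulrCA.
rewrite add1n -natr1 mulrDl addrC mul1r; congr (_ + _).
have [iu|iu] := boolP (i \in u).
  rewrite mulrCA; congr (_ * _).
  by rewrite /monomial (perm_big _ (perm_to_rem iu)) big_cons.
by have -> : count_mem i u = 0%N; [apply/count_memPn | rewrite !mul0r mulr0].
Qed.

End GaussianSteinIdentity.

(** * Moment recursion for Gaussian matrix series *)

Section GaussianMatrixMoments.
Context d (T : measurableType d) (R : realType) (P : probability T R) (N n : nat).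
Variable alpha : 'I_n -> {RV P >-> R}.
Hypothesis alpha_indep : mutually_independent alpha.
Hypothesis alpha_normal : forall i, standard_normal_rv (alpha i).
Variables (A : 'I_n -> 'M[R[i]]_N) (v : R).
Implicit Types (C D : 'M[R[i]]_N) (F : T -> 'M[R[i]]_N).

Let X w := mxcomb A (fun i => alpha i w).
Local Notation mon := (monomial alpha).

Let E_sum (I : finType) (f : I -> T -> R) :
  (forall i, P.-integrable setT (EFin \o f i)) ->
  \int[P]_w (\sum_i f i w) = \sum_i \int[P]_w f i w.
Proof.
move=> fI; have := Rintegral_lincomb (index_enum I) (fun=> 1) fI.
under eq_Rintegral do under eq_bigr do rewrite mul1r.
by under [in X in _ = X -> _]eq_bigr do rewrite mul1r.
Qed.

Let sum_int (I : finType) (f : I -> T -> R) :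
  (forall i, P.-integrable setT (EFin \o f i)) ->
  P.-integrable setT (EFin \o (fun w => \sum_i f i w)).
Proof.
move=> fI; have -> : (fun w => \sum_i f i w) = (fun w => \sum_i 1 * f i w).
  by apply/funext => w; apply: eq_bigr => i _; rewrite mul1r.
exact: integrable_lincomb.
Qed.

(* Quantifying over all monomials makes this class stable under [X w *m _]. *)
Let tame F := forall u C, P.-integrable setT (EFin \o (fun w => mon u w * Retr (C *m F w))).

Let tame_cst D : tame (fun=> D).
Proof.
move=> u C; under eq_fun do rewrite mulrC.
by apply: integrableZR; exact: mon_integrable.
Qed.

Let tame_mulX F : tame F -> tame (fun w => X w *m F w).
Proof.
move=> tF u C.
have -> : (fun w => mon u w * Retr (C *m (X w *m F w))) =
    (fun w => \sum_l 1 * (mon (l :: u) w * Retr (C *m A l *m F w))).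
  apply/funext => w; rewrite Retr_mul_mxcomb mulr_sumr; apply: eq_bigr => l _.
  by rewrite mul1r /monomial big_cons mulrCA mulrA.
by apply: integrable_lincomb => l; exact: tF.
Qed.

Let tame_mull D F : tame F -> tame (fun w => D *m F w).
Proof. by move=> tF u C; under eq_fun do rewrite mulmxA; exact: tF. Qed.

Let tame_pow F k : tame F -> tame (fun w => X w ^+ k *m F w).
Proof.
move=> tF; elim: k => [|k IH].
  by under eq_fun do rewrite mx_expr0 mul1mx.
by under eq_fun do rewrite mx_exprS -mulmxA; exact: tame_mulX.
Qed.

Let tame_powX k : tame (fun w => X w ^+ k).
Proof.
have := tame_pow k (tame_cst 1%:M).
by under eq_fun do rewrite mulmx1.
Qed.

Let tame_sandwich D k l : tame (fun w => X w ^+ k *m (D *m X w ^+ l)).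
Proof. by apply: tame_pow; apply: tame_mull; exact: tame_powX. Qed.

(** Integration by parts for a monomial times a trace: the derivative hits either the monomial or
    one of the [k] factors X, which it replaces by [A i]. The monomial is there because expanding a
    factor X in the induction multiplies by one more variable. *)
Lemma gaussian_stein k i u C :
  \int[P]_w (alpha i w * mon u w * Retr (C *m X w ^+ k)) =
  (count_mem i u)%:R * \int[P]_w (mon (rem i u) w * Retr (C *m X w ^+ k)) +
  \sum_(j < k) \int[P]_w (mon u w * Retr (C *m (X w ^+ j *m (A i *m X w ^+ (k - j.+1))))).
Proof.
elim: k u C => [|k IH] u C.
  rewrite big_ord0 addr0; under [LHS]eq_Rintegral do rewrite mx_expr0 mulmx1.
  under [X in _ = _ * X]eq_Rintegral do rewrite mx_expr0 mulmx1.
  rewrite RintegralZr //; last first.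
    have -> : (fun w => alpha i w * mon u w) = mon (i :: u).
      by apply/funext => w; rewrite /monomial big_cons.
    exact: mon_integrable.
  rewrite RintegralZr //; last exact: mon_integrable.
  by rewrite (mon_stein alpha_indep alpha_normal) mulrA.
have e1 w : alpha i w * mon u w * Retr (C *m X w ^+ k.+1) =
    \sum_l (alpha i w * mon (l :: u) w * Retr (C *m A l *m X w ^+ k)).
  rewrite mx_exprS Retr_mul_mxcomb mulr_sumr; apply: eq_bigr => l _.
  by rewrite /monomial big_cons; ring.
under eq_Rintegral do rewrite e1.
rewrite E_sum; last first.
  move=> l; have := tame_powX k (i :: l :: u) (C *m A l).
  by under eq_fun do rewrite /monomial big_cons.
under eq_bigr do rewrite IH.
rewrite big_split /=.
have e2 l : (count_mem i (l :: u))%:R *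
      \int[P]_w (mon (rem i (l :: u)) w * Retr (C *m A l *m X w ^+ k)) =
    (l == i)%:R * \int[P]_w (mon u w * Retr (C *m A l *m X w ^+ k)) +
    (count_mem i u)%:R *
      \int[P]_w (mon (l :: rem i u) w * Retr (C *m A l *m X w ^+ k)).
  rewrite -!RintegralZl //; try exact: tame_powX.
  rewrite -RintegralD //; try by apply: integrableZR; exact: tame_powX.
  apply: eq_Rintegral => w _; rewrite mulrA dmon_cons /monomial big_cons; ring.
(* Differentiating the letter just expanded leaves only [l = i], the term in which the first factor
   X is replaced by [A i], that is j = 0. *)
rewrite (eq_bigr _ (fun l _ => e2 l)) big_split /= (bigD1 i) //= eqxx mul1r.
rewrite big1 ?addr0 => [|l li]; last by rewrite (negbTE li) mul0r.
rewrite -mulr_sumr -E_sum; last by move=> l; exact: tame_powX.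
have e3 w : \sum_l mon (l :: rem i u) w * Retr (C *m A l *m X w ^+ k) =
    mon (rem i u) w * Retr (C *m X w ^+ k.+1).
  rewrite mx_exprS Retr_mul_mxcomb mulr_sumr; apply: eq_bigr => l _.
  by rewrite /monomial big_cons; ring.
under [X in _ * X]eq_Rintegral do rewrite e3.
rewrite [_ + _ * _]addrC -addrA; congr (_ + _).
rewrite big_ord_recl /= subn1 /=; congr (_ + _).
  by apply: eq_Rintegral => w _; rewrite mx_expr0 mul1mx mulmxA.
rewrite exchange_big /=; apply: eq_bigr => j _.
rewrite -E_sum; last by move=> l; exact: tame_sandwich.
apply: eq_Rintegral => w _.
rewrite /bump /= add1n mx_exprS subSS -mulmxA Retr_mul_mxcomb mulr_sumr.
by apply: eq_bigr => l _; rewrite /monomial big_cons; ring.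
Qed.

Lemma gaussian_odd_gen k u C : odd (size u + k) ->
  \int[P]_w (mon u w * Retr (C *m X w ^+ k)) = 0.
Proof.
elim: k u C => [|k IH] u C o.
  under eq_Rintegral do rewrite mx_expr0 mulmx1.
  rewrite RintegralZr //; last exact: mon_integrable.
  by rewrite (mon_odd alpha_indep alpha_normal) ?mul0r // -(addn0 (size u)).
have e w : mon u w * Retr (C *m X w ^+ k.+1) =
    \sum_l mon (l :: u) w * Retr (C *m A l *m X w ^+ k).
  rewrite mx_exprS Retr_mul_mxcomb mulr_sumr; apply: eq_bigr => l _.
  by rewrite /monomial big_cons; ring.
under eq_Rintegral do rewrite e.
rewrite E_sum; last by move=> l; exact: tame_powX.
by rewrite big1 // => l _; apply: IH; have -> : (size (l :: u) + k = size u + k.+1)%N by rewrite addnS.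
Qed.

Lemma gaussian_int k : P.-integrable setT (EFin \o (fun w => Retr (X w ^+ k))).
Proof.
have := tame_powX k [::] 1%:M.
by under eq_fun do rewrite /monomial big_nil mul1r mul1mx.
Qed.

Lemma gaussian_odd k : odd k -> \int[P]_w Retr (X w ^+ k) = 0.
Proof.
move=> ok; have := @gaussian_odd_gen k [::] 1%:M ok.
by under eq_Rintegral do rewrite /monomial big_nil mul1r mul1mx.
Qed.

Hypothesis A_herm : forall i, adj (A i) = A i.
Hypothesis A_var : forall Y (t : nat), adj Y = Y -> ~~ odd t ->
  Retr ((\sum_i A i *m A i) *m Y ^+ t) <= v * Retr (Y ^+ t).

Let trace_int k C : P.-integrable setT (EFin \o (fun w => Retr (C *m X w ^+ k))).
Proof.
have := tame_powX k [::] C.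
by under eq_fun do rewrite /monomial big_nil mul1r.
Qed.

Lemma gaussian_even_step t :
  \int[P]_w Retr (X w ^+ (2 * t.+1)) <= (2 * t + 1)%:R * v * \int[P]_w Retr (X w ^+ (2 * t)).
Proof.
have X_herm w : adj (X w) = X w by exact: mxcomb_herm.
have et : ~~ odd (2 * t) by rewrite mul2n odd_double.
have -> : (2 * t.+1 = (2 * t).+2)%N by lia.
under eq_Rintegral do rewrite mx_exprS Retr_mxcombl.
rewrite E_sum; last first.
  move=> i; have := tame_powX (2 * t).+1 [:: i] (A i).
  by under eq_fun do rewrite /monomial big_cons big_nil mulr1.
have coord i : \int[P]_w (alpha i w * Retr (A i *m X w ^+ (2 * t).+1)) <=
    (2 * t + 1)%:R * \int[P]_w Retr (A i *m A i *m X w ^+ (2 * t)).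
  have := gaussian_stein (2 * t).+1 i [::] (A i).
  rewrite /= mul0r add0r.
  under eq_Rintegral do rewrite /monomial big_nil mulr1.
  move=> ->.
  rewrite -E_sum; last by move=> j; exact: tame_sandwich.
  rewrite -RintegralZl //.
  apply: le_Rintegral => //.
  - by apply: sum_int => j; exact: tame_sandwich.
  - by apply: integrableZR; exact: trace_int.
  (* With Y = Z = X the two traces on the right coincide and the factor 2 cancels. *)
  move=> w _; have := Retr_sum_sandwich_le t (A_herm i) (X_herm w) (X_herm w).
  rewrite mulrDr -/(X w); set S := \sum_(q < _) _; set c := (2 * t + 1)%:R * _.
  suff -> : \sum_(j < (2 * t).+1) mon [::] w *
      Retr (A i *m (X w ^+ j *m (A i *m X w ^+ ((2 * t).+1 - j.+1)))) = S by lra.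
  apply: eq_bigr => j _; rewrite /monomial big_nil mul1r subSS.
  by rewrite mulmxA mxtrace_mulC !mulmxA.
apply: le_trans (ler_sum _ (fun i _ => coord i)) _.
rewrite -mulr_sumr -mulrA ler_wpM2l // -E_sum; last by move=> i; exact: trace_int.
rewrite -RintegralZl //; last exact: gaussian_int.
have e w : \sum_i Retr (A i *m A i *m X w ^+ (2 * t)) =
    Retr ((\sum_i A i *m A i) *m X w ^+ (2 * t)).
  by rewrite mulmx_suml Retr_sum.
under [leLHS]eq_Rintegral do rewrite e.
apply: le_Rintegral => //; first by apply: integrableZR; exact: gaussian_int.
by move=> w _; apply: A_var.
Qed.

Lemma gaussian_even t : 0 <= v ->
  \int[P]_w Retr (X w ^+ (2 * t)) <= (odd_fact t)%:R * v ^+ t * N%:R.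
Proof.
move=> v0; elim: t => [|t IH].
  rewrite muln0 expr0 mulr1 /odd_fact big_ord0 mul1r.
  under eq_Rintegral do rewrite mx_expr0 mxtrace1.
  rewrite Rintegral_cst // -[X in fine X]/(P setT) probability_setT /= mulr1.
  by rewrite -(rmorph_nat (real_complex R)).
apply: le_trans (gaussian_even_step t) _.
apply: (le_trans (ler_wpM2l _ IH)); first by rewrite mulr_ge0.
by rewrite odd_factS exprS natrM le_eqVlt; apply/orP; left; apply/eqP; ring.
Qed.

End GaussianMatrixMoments.

(** * The spectral norm through extreme eigenvalues *)

Section NormByLambdaMax.
Context {R : realType} {N : nat}.
Implicit Types (M U : 'M[R[i]]_N).

Lemma eigdecN M U y : eigdec M U y -> eigdec (- M) U (fun j => - y j).
Proof.
move=> [e1 e2 ->]; split => //; rewrite -mulNmx -mulmxN; congr (_ *m _ *m _).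
by rewrite -linearN /=; congr diag_mx; apply/rowP => j; rewrite !mxE rmorphN.
Qed.

Lemma le_spec_norm M (theta : R) : (0 < N)%N -> adj M = M ->
  theta <= spec_norm_mx M <-> theta <= lambda_max_mx M \/ theta <= lambda_max_mx (- M).
Proof.
move=> N0 /herm_eigdec[U [y dM]].
have [j [-> mj]] := spec_norm_eigdec N0 dM.
have [k [-> mk]] := lambda_max_eigdec N0 dM.
have [l [-> ml]] := lambda_max_eigdec N0 (eigdecN dM).
split=> [|[h|h]].
- case: (ler0P (y j)) => _ h; first by right; exact: le_trans h (ml j).
  by left; exact: le_trans h (mk j).
- by apply: le_trans h _; apply: le_trans (mj k); exact: ler_norm.
- by apply: le_trans h _; apply: le_trans (mj l); rewrite -normrN; exact: ler_norm.
Qed.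

End NormByLambdaMax.

(** * Tail bounds for Hermitian matrix series *)

Section MatrixSeriesTail.
Context d (T : measurableType d) (R : realType) (P : probability T R) (N n : nat).
Variable alpha : 'I_n -> {RV P >-> R}.
Hypothesis alpha_indep : mutually_independent alpha.
Hypothesis alpha_law :
  (forall i, standard_normal_rv (alpha i)) \/ (forall i, rademacher_rv (alpha i)).
Hypothesis N_gt0 : (0 < N)%N.

Let point w := fun i => alpha i w.

Lemma variance_bound (A : 'I_n -> 'M[R[i]]_N) Y (t : nat) :
  (forall i, adj (A i) = A i) -> adj Y = Y -> ~~ odd t ->
  Retr ((\sum_i A i *m A i) *m Y ^+ t) <=
  spec_norm_mx (\sum_i A i *m A i) * Retr (Y ^+ t).
Proof.
move=> hA hY et; set B := \sum_i _.
have hB : adj B = B.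
  have adj0 : adj (0 : 'M[R[i]]_N) = 0 by rewrite trmx0 map_mx0.
  rewrite /B (big_morph (fun M : 'M[R[i]]_N => adj M) (@ctmxD R N N) adj0).
  by apply: eq_bigr => i _; rewrite ctmxM hA.
have [V [b dB]] := herm_eigdec hB.
have [j [-> mj]] := spec_norm_eigdec N_gt0 dB.
apply: (Retr_mul_le hY dB) => // k.
by apply: le_trans (mj k); exact: ler_norm.
Qed.

Lemma measurable_series_ge (A : 'I_n -> 'M[R[i]]_N) (theta : R) :
  (forall i, adj (A i) = A i) -> 0 <= theta ->
  measurable [set w | (theta <= lambda_max_mx (mxcomb A (point w)))%R].
Proof.
move=> hA t0; apply: measurable_lambda_max_ge => // [w|k]; first exact: mxcomb_herm.
have := @measurable_Retr_pow _ T R N n A point 1%:M k.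
by under eq_fun do rewrite mul1mx; apply => l; exact: measurable_funP.
Qed.

Lemma lambda_max_series_tail (A : 'I_n -> 'M[R[i]]_N) (theta : R) :
  (forall i, adj (A i) = A i) -> 0 <= theta ->
  (P [set w | (theta <= lambda_max_mx (mxcomb A (point w)))%R] <=
   (N%:R * expR (- theta ^+ 2 / (2 * spec_norm_mx (\sum_i A i *m A i))))%:E)%E.
Proof.
move=> hA t0; set v := spec_norm_mx _.
have v_ge0 : 0 <= v by exact: sqrtr_ge0.
have mS := measurable_series_ge hA t0.
(* For v = 0 the quotient takes the default value 0, so the bound is N >= 1 and holds trivially. *)
have [v0|v0] := eqVneq v 0.
  rewrite v0 mulr0 invr0 mulr0 expR0 mulr1.
  by apply: le_trans (probability_le1 P mS) _; rewrite lee_fin ler1n.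
have v_gt0 : 0 < v by rewrite lt_neqAle eq_sym v0.
have hV Y t : adj Y = Y -> ~~ odd t ->
    Retr ((\sum_i A i *m A i) *m Y ^+ t) <= v * Retr (Y ^+ t).
  exact: variance_bound.
have hX w : adj (mxcomb A (point w)) = mxcomb A (point w) by exact: mxcomb_herm.
case: alpha_law => [gauss|rad].
  apply: lambda_max_tail => //.
  - by move=> k; exact: gaussian_int.
  - by move=> k; exact: gaussian_odd.
  - by move=> t; exact: gaussian_even.
have E k : P.-integrable setT (EFin \o (fun w => Retr (mxcomb A (point w) ^+ k))) /\
    \int[P]_w Retr (mxcomb A (point w) ^+ k) =
    (2^-1) ^+ n * \sum_s Retr (mxcomb A (sgnv s) ^+ k).
  apply: (rademacher_expectation alpha_indep rad (f := fun a => Retr (mxcomb A a ^+ k))).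
  have := @measurable_Retr_pow _ T R N n A point 1%:M k.
  by under eq_fun do rewrite mul1mx; apply => l; exact: measurable_funP.
apply: lambda_max_tail => //.
- by move=> k; have [] := E k.
- by move=> k ok; rewrite (E k).2 rad_odd // mulr0.
move=> t; rewrite (E (2 * t)%N).2.
have c0 : 0 <= (2^-1 : R) ^+ n by rewrite exprn_ge0 // invr_ge0.
apply: le_trans (ler_wpM2l c0 (rad_even hA hV t v_ge0)) _.
under eq_bigr do rewrite mx_expr0 mxtrace1.
rewrite sumr_const card_ffun card_bool card_ord -[X in _ * (_ * X)]mulr_natl natrX mulrCA.
rewrite [_ ^+ n * (_ * _)]mulrA -exprMn mulVf ?expr1n ?mul1r ?pnatr_eq0 //.
by rewrite -(rmorph_nat (real_complex R)).
Qed.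

Lemma spec_norm_series_tail (A : 'I_n -> 'M[R[i]]_N) (theta : R) :
  (forall i, adj (A i) = A i) -> 0 <= theta ->
  (P [set w | (theta <= spec_norm_mx (mxcomb A (point w)))%R] <=
   ((2 * N)%:R * expR (- theta ^+ 2 / (2 * spec_norm_mx (\sum_i A i *m A i))))%:E)%E.
Proof.
(* Negation leaves the squares, hence the variance, unchanged, so a union bound over both signs
   gives the factor 2. *)
move=> hA t0; pose nA i := - A i.
have hnA i : adj (nA i) = nA i.
  by rewrite /nA -{2}(hA i); apply/matrixP => j k; rewrite !mxE rmorphN.
have eN w : - mxcomb A (point w) = mxcomb nA (point w).
  by rewrite /mxcomb -sumrN; apply: eq_bigr => i _; rewrite scalerN.
have e2 : \sum_i nA i *m nA i = \sum_i A i *m A i.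
  by apply: eq_bigr => i _; rewrite /nA mulNmx mulmxN opprK.
have -> : [set w | (theta <= spec_norm_mx (mxcomb A (point w)))%R] =
    [set w | (theta <= lambda_max_mx (mxcomb A (point w)))%R] `|`
    [set w | (theta <= lambda_max_mx (mxcomb nA (point w)))%R].
  by apply/seteqP; split=> w /=; rewrite -eN (le_spec_norm theta N_gt0 (mxcomb_herm hA _)).
apply: le_trans (measureU2 _ _ _) _; try exact: measurable_series_ge.
rewrite mul2n -addnn natrD mulrDl EFinD.
apply: leeD; first exact: lambda_max_series_tail.
by rewrite -e2; exact: lambda_max_series_tail.
Qed.

End MatrixSeriesTail.

(** * Transfer to T-product tensors *)

Unset Implicit Arguments.

Theorem theorem1 (R : realType) (m p n : nat) (d : measure_display)
  (T : measurableType d) (P : probability T R)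
  (A : 'I_n -> tensor R m m p) (alpha : 'I_n -> {RV P >-> R}) :
  (1 <= m)%N -> (1 <= p)%N -> (1 <= n)%N ->
  (forall i, tHermitian (A i)) ->
  mutually_independent alpha ->
  ((forall i, standard_normal_rv (alpha i)) \/ (forall i, rademacher_rv (alpha i))) ->
  let sigma2 := tnorm (\sum_(i < n) tprod (A i) (A i)) in
  forall theta : R, 0 <= theta ->
    (P [set w | (theta <= tlambda_max (tcomb (fun i => alpha i w) A))%R]
       <= ((m * p)%:R * expR (- theta ^+ 2 / (2 * sigma2)))%:E)%E /\
    (P [set w | (theta <= tnorm (tcomb (fun i => alpha i w) A))%R]
       <= ((2 * m * p)%:R * expR (- theta ^+ 2 / (2 * sigma2)))%:E)%E.
Proof.
move=> m1 p1 _ hA indep law sigma2 theta t0.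
(* The size of the block circulant matrix is the source of the factor mp. *)
have card : (\sum_(r < p) m = m * p)%N by rewrite sum_nat_const card_ord mulnC.
have N0 : (0 < \sum_(r < p) m)%N by rewrite card muln_gt0 m1.
pose B i := bcirc (A i).
have hB i : adj (B i) = B i by rewrite -bcirc_tconjT (hA i).
have eX a : bcirc (tcomb a A) = mxcomb B a.
  by rewrite /tcomb bcirc_sum; apply: eq_bigr => i _; rewrite bcirc_scale.
have eS : sigma2 = spec_norm_mx (\sum_i B i *m B i).
  rewrite /sigma2 /tnorm bcirc_sum; congr spec_norm_mx.
  by apply: eq_bigr => i _; rewrite bcirc_tprod.
rewrite eS -mulnA -card; split.
  under eq_set do rewrite /tlambda_max eX.
  exact: lambda_max_series_tail.
under eq_set do rewrite /tnorm eX.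
exact: spec_norm_series_tail.
Qed.
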